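(* For every $\delta\in(0,1)$ there exist a function $g\in L^1[0,1]$ and a weight function $\mu$ on $[0,1]$ with $0<\mu(x)\le 1$ and $|\{x\in[0,1]:\mu(x)=1\}|>1-\delta$ such that, writing $c_k(g)=\int_0^1 g(x)W_k(x)\,dx$: (i) the Fourier--Walsh coefficients of $g$ are strictly decreasing, i.e. $c_{k+1}(g)<c_k(g)$ for all $k\ge 0$; (ii) the Fourier--Walsh series of $g$ converges to $g$ in the $L^1[0,1]$ norm, i.e. $\lim_{m\to\infty}\int_0^1\left|\sum_{k=0}^m c_k(g)W_k(x)-g(x)\right|dx=0$; (iii) $g$ is universal for $L^1_\mu[0,1]$ with respect to signs of its Fourier--Walsh coefficients, i.e. for every $f\in L^1_\mu[0,1]$ there exist numbers $\delta_k\in\{-1,1\}$, $k=0,1,2,\dots$, such that $$\lim_{m\to\infty}\int_0^1\left|\sum_{k=0}^m\delta_k c_k(g)W_k(x)-f(x)\right|\mu(x)\,dx=0.$$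
   Context: All functions are real-valued. $|E|$ denotes the Lebesgue measure of a measurable set $E\subseteq[0,1]$. A weight function is a (Lebesgue) measurable function $\mu$ on $[0,1]$ with $0<\mu(x)\le 1$. $L^1_\mu[0,1]$ is the class of measurable functions $f$ on $[0,1]$ with $\int_0^1|f(x)|\mu(x)\,dx<\infty$. The Walsh system $\{W_n\}_{n=0}^\infty$ on $[0,1]$ is defined via the Rademacher functions $R_n(x)=\operatorname{sign}(\sin 2^n\pi x)$, $x\in[0,1]$, $n=1,2,\dots$: $W_0(x)\equiv 1$, and for $n\ge 1$ with binary expansion $n=2^{k_1}+2^{k_2}+\dots+2^{k_p}$, $k_1>k_2>\dots>k_p\ge 0$, $W_n(x)=\prod_{i=1}^p R_{k_i+1}(x)$. *)

(* Defs.v *)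
(* Setting: MathComp-Analysis, over an arbitrary [R : realType]. *)
From HB Require Import structures.
From mathcomp Require Import all_boot all_order all_algebra.
From mathcomp Require Import all_classical all_reals all_analysis.
Import Order.TTheory GRing.Theory Num.Theory.
Import numFieldNormedType.Exports.

Set Implicit Arguments.
Unset Strict Implicit.
Unset Printing Implicit Defensive.

Local Open Scope classical_set_scope.
Local Open Scope ring_scope.

(* The carrier of [completed_lebesgue_measure]: it is [R] itself, but its
   measurable sets are the Lebesgue measurable sets, whereas those of
   [measurableTypeR R] are only the Borel sets. *)
Notation lebesgueR R := (caratheodory_type (mu_ext (@wlength R idfun))).

Notation leb := completed_lebesgue_measure.

(* A function on [0, 1] is a total function on the line of which only the
   restriction to [0, 1] is ever used. *)
Notation I01 R := ([set` `[0 : R, 1 : R]] : set (lebesgueR R)).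

Section Walsh.
Context {R : realType}.
Implicit Types (f g mu : lebesgueR R -> R).

Definition rademacher (n : nat) (x : R) : R :=
  Num.sg (sin (2 ^+ n * pi * x)).

(* [odd (n %/ 2 ^ k)] says that the binary expansion of [n] contains [2 ^ k];
   such a [k] satisfies [k < n]. The empty product gives [walsh 0 = 1]. *)
Definition walsh (n : nat) (x : R) : R :=
  \prod_(k < n | odd (n %/ 2 ^ k)) rademacher k.+1 x.

Definition walsh_coef g (k : nat) : R :=
  \int[leb]_(x in I01 R) (g x * walsh k x).

Definition L1 g : Prop := leb.-integrable (I01 R) (EFin \o g).

Definition weight mu : Prop :=
  measurable_fun (I01 R) mu /\ (forall x, I01 R x -> 0 < mu x <= 1).

Definition weightedL1 mu f : Prop :=
  measurable_fun (I01 R) f /\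
  (\int[leb]_(x in I01 R) (`|f x| * mu x)%:E < +oo)%E.

End Walsh.

(* Main.v *)
(** A function of finitely many binary digits x_0, x_1, ... of x is a Walsh
polynomial, and R_(k+1) = (-1)^(x_k) almost everywhere. Let f be constant on a
dyadic interval I of rank m and let theta, with values 1 and -1, be a bent function
of digits of rank at least m times one further Rademacher function. All the Walsh
coefficients of f 1_I theta have the same modulus b; when the indices below its
spectrum are filled up with the coefficient b, this adds b times a difference of
Dirichlet kernels, whose L^1 norm is at most 2b. By orthogonality all partial sums,
with these signs or with positive signs, are small in L^2 if m is large, and the
complete sum with positive signs is small in L^1 if b is small.

On half of I the function f theta is f, on the other half it is -f. Adding on the bad
half 2f times a new theta repairs half of it, and so on: after nu rounds the sum is f
off a set A of measure 2^-nu, and (1 - 2^nu) f on A. Blocks of this kind, with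
decreasing moduli, are concatenated for a sequence of targets in which each Walsh
polynomial with rational coefficients occurs infinitely often. The moduli, made
strictly decreasing by adding 2^-k, are the coefficients of g, and the series
converges in L^1 since the blocks with positive signs are small.

The exceptional sets A_n have a summable measure, and the weight is taken so small on
A_n that the n-th block does the work of its target in the weighted norm. To represent
f, use the signs of the n-th block if its target brings the partial sum to less than half
of the present distance from f, and positive signs otherwise. Since the targets are
dense and recurrent, the distance tends to 0. *)

Require Import Defs.
From mathcomp Require Import all_boot all_order all_algebra.
From mathcomp Require Import all_classical all_reals all_analysis.
From mathcomp Require Import measurable_realfun ring lra.
Import Order.TTheory GRing.Theory Num.Theory.
Import numFieldNormedType.Exports.

Set Implicit Arguments.
Unset Strict Implicit.
Unset Printing Implicit Defensive.

Local Open Scope classical_set_scope.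
Local Open Scope ring_scope.

(** * Binary digits and the mean *)

(** A Walsh sum with indices at least 2^n has mean zero on each dyadic interval of rank n, so a late
    block cannot be close to a nonzero target f of rank n in the unweighted norm. The compensation
    (1 - 2^nu) f, on a set A that fills a proportion 2^-nu of every such interval, is the price; the
    weight pays it. Blocks carry two tolerances because two mechanisms act. A complete block is as
    accurate as desired: its error is b times a difference of Dirichlet kernels, and b is lowered by
    spreading the same function over more frequencies. A truncated block is controlled only by
    Parseval, and b^2 times the number of coefficients does not decrease with b; this bound shrinks
    only with the length of I. Hence a target is treated interval by interval: at any time at most
    one interval has an incomplete sum, so its error is not multiplied by the number of
    intervals. *)

Lemma integrable_indicZ (d : measure_display) (T : measurableType d)
    (R : realType) (mu : {measure set T -> \bar R}) (D A : set T) (a : R) :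
  measurable D -> measurable A -> (mu D < +oo)%E ->
  mu.-integrable D (EFin \o (fun t => a * \1_A t)).
Proof.
move=> mD mA D1.
have -> : EFin \o (fun t => a * \1_A t) =
    (fun t => a%:E * (EFin \o (\1_A : T -> R)) t)%E.
  by apply/funext => t /=; rewrite EFinM.
apply: integrableZl => //; apply/integrableP; split.
  by apply/measurable_EFinP; exact: measurable_indic.
apply: le_lt_trans D1; rewrite -[X in (_ <= X)%E]mul1e.
rewrite -integral_cst//; apply: ge0_le_integral => //=.
  by apply/measurable_EFinP; apply: measurableT_comp => //; exact: measurable_indic.
by move=> t _; rewrite lee_fin indicE; case: (_ \in _); rewrite ?normr1// normr0.
Qed.

Lemma integrable_simple (d : measure_display) (T : measurableType d)
    (R : realType) (mu : {measure set T -> \bar R}) (D : set T)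
    (I : finType) (a : I -> R) (A : I -> set T) (f : T -> R) :
  measurable D -> (forall i, measurable (A i)) -> (mu D < +oo)%E ->
  {in D, f =1 (fun t => \sum_i a i * \1_(A i) t)} ->
  mu.-integrable D (EFin \o f).
Proof.
move=> mD mA D1 h.
apply: (@eq_integrable _ _ _ _ _ mD (fun t => \sum_i
    (a i * \1_(A i) t)%R%:E)%E).
  by move=> t /h /= ->; rewrite sumEFin.
by apply: integrable_sum => // i _; apply: integrable_indicZ.
Qed.

Lemma Rintegral_simple (d : measure_display) (T : measurableType d)
    (R : realType) (mu : {measure set T -> \bar R}) (D : set T)
    (I : finType) (a : I -> R) (A : I -> set T) (f : T -> R) :
  measurable D -> (forall i, measurable (A i)) -> (mu D < +oo)%E ->
  {in D, f =1 (fun t => \sum_i a i * \1_(A i) t)} ->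
  \int[mu]_(t in D) f t = \sum_i a i * fine (mu (A i `&` D)).
Proof.
move=> mD mA D1 h; rewrite (eq_Rintegral _ h) /Rintegral.
pose g i := EFin \o (fun t => a i * \1_(A i) t).
under eq_integral do rewrite -sumEFin.
rewrite (@integral_sum _ _ _ _ _ mD _ g)//; last first.
  by move=> i; exact: integrable_indicZ.
rewrite -sum_fine => [|i _]; last first.
  by rewrite integrable_fin_num//; exact: integrable_indicZ.
apply: eq_bigr => i _; rewrite /g/=.
under eq_integral do rewrite EFinM.
rewrite integralZl//; last first.
  have := @integrable_indicZ _ _ _ mu D (A i) 1 mD (mA i) D1.
  by apply: eq_integrable => // t _ /=; rewrite mul1r.
rewrite integral_indic// fineM// ge0_fin_numE ?measure_ge0//.
by apply: le_lt_trans D1; apply: le_measure; rewrite ?inE//; exact: measurableI.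
Qed.

Section Bits.
Context {R : realType}.
Implicit Types (F G : (nat -> bool) -> R) (x y : nat -> bool).

(* Binary digits of [t] in [0, 1). At a dyadic point the Rademacher functions
   vanish, so there, but only there, they are not given by the digits. *)
Definition bits (t : R) : nat -> bool :=
  fun k => odd (Num.truncn (2 ^+ k.+1 * t)).

Definition rad (k : nat) x : R := (-1) ^+ (x k).

Definition depends_on (n : nat) F :=
  forall x y, (forall k, (k < n)%N -> x k = y k) -> F x = F y.

Definition finite_depth F := exists n, depends_on n F.

(** The interval is half open because it is tiled by the dyadic intervals of each rank; at t = 1 the
    digits would be those of 0. *)
Definition mean F : R :=
  \int[leb]_(t in ([set` `[0, 1[ ] : set (lebesgueR R))) F (bits t).

Definition mean_norm F : R := mean (fun x => `|F x|).

Lemma measurable_itv_leb (i : interval R) :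
  measurable ([set` i] : set (lebesgueR R)).
Proof. by apply: sub_caratheodory; exact: measurable_itv. Qed.

Lemma leb_itv (i : interval R) :
  leb ([set` i] : set (lebesgueR R)) = lebesgue_measure [set` i].
Proof. by []. Qed.

(** The first k+1 binary digits of t are the leading digits of the n-digit number j, and the
    division by 2^(n-k-1) drops the others. *)
Lemma truncn_dyadic (n j k : nat) (t : R) : (k < n)%N ->
  j%:R <= 2 ^+ n * t < j.+1%:R ->
  Num.truncn (2 ^+ k.+1 * t) = (j %/ 2 ^ (n - k.+1))%N.
Proof.
move=> kn /andP[h1 h2]; apply: truncn_def.
set q := (2 ^ (n - k.+1))%N.
have q0 : (0 < q)%N by rewrite expn_gt0.
have q0R : 0 < q%:R :> R by rewrite ltr0n.
have E : 2 ^+ n * t = 2 ^+ k.+1 * t * q%:R :> R.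
  by rewrite /q natrX mulrAC -exprD subnKC.
rewrite -(ler_pM2r q0R) -(ltr_pM2r q0R) -E -!natrM; apply/andP; split.
  by apply: le_trans h1; rewrite ler_nat leq_divM.
by apply: (lt_le_trans h2); rewrite ler_nat ltn_ceil.
Qed.

Lemma dep_le m n F : (m <= n)%N -> depends_on m F -> depends_on n F.
Proof. by move=> mn h x y e; apply: h => k km; apply: e; apply: leq_trans mn. Qed.

Lemma dep_dyadic n F j (t : R) : depends_on n F ->
  j%:R <= 2 ^+ n * t < j.+1%:R -> F (bits t) = F (bits (j%:R / 2 ^+ n)).
Proof.
move=> dF jt; apply: dF => k kn; rewrite /bits (truncn_dyadic kn jt).
rewrite (@truncn_dyadic n j)// mulrC divfK ?expf_neq0//.
by rewrite lexx ltr_nat ltnSn.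
Qed.

Lemma dyadic_index (n : nat) (t : R) : 0 <= t < 1 ->
  exists j : 'I_(2 ^ n), forall i : 'I_(2 ^ n),
    (i%:R / 2 ^+ n <= t < i.+1%:R / 2 ^+ n) = (i == j).
Proof.
move=> /andP[t0 t1].
have p2 : 0 < 2 ^+ n :> R by rewrite exprn_gt0.
have tn0 : 0 <= 2 ^+ n * t by rewrite mulr_ge0// ltW.
have jn : (Num.truncn (2 ^+ n * t) < 2 ^ n)%N.
  by rewrite truncn_lt_nat// natrX -ltr_pdivlMl// mulVf ?lt0r_neq0.
exists (Ordinal jn) => i; rewrite ler_pdivrMr// ltr_pdivlMr// [t * _]mulrC.
by rewrite -truncn_eq// eq_sym.
Qed.

Lemma fin_simple n F : depends_on n F -> {in ([set` `[0, 1[ ] : set (lebesgueR R)),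
  (fun t => F (bits t)) =1 (fun t => \sum_(j < 2 ^ n)
    F (bits (j%:R / 2 ^+ n)) *
    \1_([set` `[j%:R / 2 ^+ n, j.+1%:R / 2 ^+ n[ ] : set (lebesgueR R)) t)}.
Proof.
move=> dF t /set_mem /=; rewrite in_itv/= => t01.
have [j jP] := dyadic_index n t01.
rewrite (bigD1 j)//= big1 ?addr0 => [|i /negbTE ij].
  have := jP j; rewrite eqxx => jt.
  rewrite indicE mem_set ?mulr1; last by rewrite /= in_itv/=.
  have p2 : 0 < 2 ^+ n :> R by rewrite exprn_gt0.
  by apply: dep_dyadic => //; move: jt; rewrite ler_pdivrMr// ltr_pdivlMr// mulrC.
by rewrite indicE memNset ?mulr0//= in_itv/= jP ij.
Qed.

Lemma leb01 : leb ([set` `[0, 1[ ] : set (lebesgueR R)) = 1%E.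
Proof. by rewrite leb_itv lebesgue_measure_itv/= lte_fin ltr01 sube0. Qed.

Lemma leb_dyadic (n j : nat) :
  leb ([set` `[j%:R / 2 ^+ n, j.+1%:R / 2 ^+ n[ ] : set (lebesgueR R)) = (2 ^- n)%:E.
Proof.
rewrite leb_itv lebesgue_measure_itv/= lte_fin ltr_pM2r ?invr_gt0 ?exprn_gt0//.
by rewrite ltr_nat ltnSn -EFinB/= -mulrBl -natrB// subSnn mul1r.
Qed.

Lemma leb01_lty : (leb ([set` `[0%R, 1%R[ ] : set (lebesgueR R)) < +oo)%E.
Proof. by rewrite leb01 ltry. Qed.

Lemma fin_integrable F : finite_depth F ->
  leb.-integrable ([set` `[0, 1[ ] : set (lebesgueR R)) (EFin \o (fun t => F (bits t))).
Proof.
move=> [n dF]; apply: (integrable_simple _ _ _ (fin_simple dF)).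
- exact: measurable_itv_leb.
- by move=> i; exact: measurable_itv_leb.
- exact: leb01_lty.
Qed.

(** This turns the integral into a finite average; linearity, monotonicity and orthogonality of
    means are derived from it without further integration. *)
Lemma mean_sum n F : depends_on n F ->
  mean F = 2 ^- n * \sum_(j < 2 ^ n) F (bits (j%:R / 2 ^+ n)).
Proof.
move=> dF.
have p2 : 0 < 2 ^+ n :> R by rewrite exprn_gt0.
rewrite /mean (Rintegral_simple _ _ _ (fin_simple dF))//; first last.
- exact: leb01_lty.
- by move=> i; exact: measurable_itv_leb.
- exact: measurable_itv_leb.
rewrite mulr_sumr; apply: eq_bigr => j _.
rewrite setIidl; last first.
  move=> t /=; rewrite !in_itv/= => /andP[h1 h2]; apply/andP; split.
    by apply: le_trans h1; rewrite divr_ge0// ltW.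
  apply: (lt_le_trans h2); rewrite ler_pdivrMr// mul1r -natrX ler_nat; exact: ltn_ord.
rewrite mulrC; congr (_ * _); exact: (congr1 fine (leb_dyadic n j)).
Qed.

End Bits.

Lemma fin_dep2 {R : realType} (F G : (nat -> bool) -> R) :
  finite_depth F -> finite_depth G -> exists n, depends_on n F /\ depends_on n G.
Proof.
move=> [n dF] [m dG]; exists (maxn n m).
by split; [apply: dep_le dF; exact: leq_maxl|apply: dep_le dG; exact: leq_maxr].
Qed.

(** * Linearity, order and norm of means *)

Section Expectation.
Context {R : realType}.
Implicit Types (F G H : (nat -> bool) -> R) (x y : nat -> bool).

Lemma dep_rad n k : (k < n)%N -> depends_on n (rad k : _ -> R).
Proof. by move=> kn x y e; rewrite /rad e. Qed.

Lemma dep2 n F G (op : R -> R -> R) :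
  depends_on n F -> depends_on n G -> depends_on n (fun x => op (F x) (G x)).
Proof. by move=> f g x y e; rewrite (f x y)// (g x y). Qed.

Lemma dep1 n F (op : R -> R) : depends_on n F -> depends_on n (fun x => op (F x)).
Proof. by move=> f x y e; rewrite (f x y). Qed.

Lemma dep_big (op : R -> R -> R) (idx : R) n (I : Type) (s : seq I) (P : pred I)
    (F : I -> (nat -> bool) -> R) : (forall i, P i -> depends_on n (F i)) ->
  depends_on n (fun x => \big[op/idx]_(i <- s | P i) F i x).
Proof. by move=> h x y e; apply: eq_bigr => i Pi; exact: h. Qed.

Lemma fin_cst (c : R) : finite_depth (fun=> c). Proof. by exists 0%N. Qed.
Lemma fin_rad k : finite_depth (rad k : _ -> R).
Proof. by exists k.+1; exact: dep_rad. Qed.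
Lemma fin2 F G (op : R -> R -> R) :
  finite_depth F -> finite_depth G -> finite_depth (fun x => op (F x) (G x)).
Proof. by move=> f g; have [n [dF dG]] := fin_dep2 f g; exists n; exact: dep2. Qed.
Lemma fin1 F (op : R -> R) : finite_depth F -> finite_depth (fun x => op (F x)).
Proof. by move=> [n f]; exists n; exact: dep1. Qed.
Lemma finD F G : finite_depth F -> finite_depth G -> finite_depth (fun x => F x + G x).
Proof. exact: (fin2 (fun a b => a + b)). Qed.
Lemma finM F G : finite_depth F -> finite_depth G -> finite_depth (fun x => F x * G x).
Proof. exact: (fin2 (fun a b => a * b)). Qed.
Lemma finN F : finite_depth F -> finite_depth (fun x => - F x).
Proof. exact: (fin1 (fun a => - a)). Qed.
Lemma fin_norm F : finite_depth F -> finite_depth (fun x => `|F x|).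
Proof. exact: (fin1 (fun a => `|a|)). Qed.
Lemma finX k F : finite_depth F -> finite_depth (fun x => F x ^+ k).
Proof. exact: (fin1 (fun a => a ^+ k)). Qed.
Lemma fin_big (op : R -> R -> R) (idx : R) (I : Type) (s : seq I) (P : pred I)
    (F : I -> (nat -> bool) -> R) : (forall i, finite_depth (F i)) ->
  finite_depth (fun x => \big[op/idx]_(i <- s | P i) F i x).
Proof.
move=> h; elim: s => [|i s IH].
  by exists 0%N => x y _; rewrite !big_nil.
have [n [d1 d2]] := fin_dep2 (h i) IH; exists n => x y e.
by rewrite !big_cons (d1 x y e) (d2 x y e).
Qed.

Lemma meanD F G : finite_depth F -> finite_depth G -> mean (fun x =>
  F x + G x) = mean F + mean G.
Proof.
move=> f g; have [n [dF dG]] := fin_dep2 f g.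
have dFG := dep2 (fun a b => a + b) dF dG.
by rewrite (mean_sum dF) (mean_sum dG) (mean_sum dFG) -mulrDr big_split.
Qed.

Lemma meanZ (c : R) F : finite_depth F -> mean (fun x => c * F x) = c * mean F.
Proof.
move=> [n dF]; have dcF := dep1 (fun a => c * a) dF.
by rewrite (mean_sum dF) (mean_sum dcF) -mulr_sumr mulrCA.
Qed.

Lemma mean_le F G : finite_depth F -> finite_depth G -> (forall x, F x <= G x) ->
  mean F <= mean G.
Proof.
move=> f g FG; have [n [dF dG]] := fin_dep2 f g.
rewrite (mean_sum dF) (mean_sum dG) ler_pM2l ?invr_gt0 ?exprn_gt0//.
by apply: ler_sum.
Qed.

Lemma mean_cst (c : R) : mean (fun=> c) = c.
Proof. by rewrite (@mean_sum _ 0)// expr0 invr1 mul1r big_ord1. Qed.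

Lemma mean_bigsum (I : Type) (s : seq I) (P : pred I) (F : I -> (nat -> bool) -> R) :
  (forall i, finite_depth (F i)) ->
  mean (fun x => \sum_(i <- s | P i) F i x) = \sum_(i <- s | P i) mean (F i).
Proof.
move=> h; elim: s => [|i s IH].
  by rewrite big_nil -[RHS]mean_cst; congr mean; apply/funext => x; rewrite big_nil.
rewrite big_cons -IH; case: ifP => Pi.
  rewrite -meanD//; last exact: fin_big.
  by congr mean; apply/funext => x; rewrite big_cons Pi.
by congr mean; apply/funext => x; rewrite big_cons Pi.
Qed.

Lemma sum_pairs0 (f : nat -> R) m : (forall i, f i.*2 + f i.*2.+1 = 0) ->
  \sum_(j < m.*2) f j = 0.
Proof.
by move=> h; elim: m => [|m IH]; rewrite ?big_ord0// doubleS !big_ord_recr/= IH add0r.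
Qed.

Lemma bits_dyadic n j k : (k < n)%N ->
  bits (j%:R / 2 ^+ n : R) k = odd (j %/ 2 ^ (n - k.+1)).
Proof.
move=> kn; rewrite /bits (@truncn_dyadic _ n j)// mulrC divfK ?expf_neq0//.
by rewrite lexx ltr_nat ltnSn.
Qed.

(** The intervals 2i and 2i+1 of rank n+1 agree in the first n digits and differ in the next one, so
    their contributions cancel in pairs. *)
Lemma mean_rad0 n F : depends_on n F -> mean (fun x => F x * rad n x) = 0.
Proof.
move=> dF; have d1 : depends_on n.+1 (fun x => F x * rad n x).
  by apply: dep2; [exact: dep_le dF|exact: dep_rad].
rewrite (mean_sum d1) expnS mul2n.
pose f (j : nat) := F (bits (j%:R / 2 ^+ n.+1 : R)) * rad n (bits (j%:R / 2 ^+ n.+1 : R)).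
suff /(sum_pairs0 (2 ^ n)) -> : forall i, f i.*2 + f i.*2.+1 = 0 by rewrite mulr0.
move=> i; rewrite /f.
have -> : F (bits (i.*2.+1%:R / 2 ^+ n.+1 : R)) = F (bits (i.*2%:R / 2 ^+ n.+1 : R)).
  apply: dF => k kn; rewrite !bits_dyadic ?(leqW kn)//.
  by rewrite subSn// expnS !divnMA !divn2 /= uphalf_double doubleK.
rewrite -mulrDr /rad !bits_dyadic// !subnn !divn1/= odd_double/=.
by rewrite expr0 expr1 subrr mulr0.
Qed.

Lemma mean_norm_ge0 F : finite_depth F -> 0 <= mean_norm F.
Proof.
move=> f; rewrite -(mean_cst 0); apply: mean_le => //; first exact: fin_cst.
exact: fin_norm.
Qed.

Lemma mean_norm_le F G : finite_depth F -> finite_depth G -> (forall x, `|F x| <=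
  `|G x|) -> mean_norm F <= mean_norm G.
Proof. by move=> f g; apply: mean_le; exact: fin_norm. Qed.

Lemma mean_normD F G : finite_depth F -> finite_depth G -> mean_norm (fun x =>
  F x + G x) <= mean_norm F + mean_norm G.
Proof.
move=> f g; rewrite /mean_norm -meanD; try exact: fin_norm.
apply: mean_le => [||x]; last exact: ler_normD.
  by apply: fin_norm; exact: finD.
by apply: finD; exact: fin_norm.
Qed.

Lemma mean_normN F : mean_norm (fun x => - F x) = mean_norm F.
Proof. by congr mean; apply/funext => x; rewrite normrN. Qed.

Lemma mean_normB F G : finite_depth F -> finite_depth G -> mean_norm (fun x =>
  F x - G x) <= mean_norm F + mean_norm G.
Proof. by move=> f g; rewrite -(mean_normN G) mean_normD//; exact: finN. Qed.

Lemma mean_normZ (c : R) F : finite_depth F -> mean_norm (fun x =>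
  c * F x) = `|c| * mean_norm F.
Proof.
move=> f; rewrite -meanZ; last exact: fin_norm.
by congr mean; apply/funext => x; rewrite normrM.
Qed.

Lemma mean_norm_cst (c : R) : mean_norm (fun=> c) = `|c|.
Proof. exact: mean_cst. Qed.

(** Cauchy-Schwarz, in the form that the variance of |F| is nonnegative. *)
Lemma mean_norm_sqr F (c : R) : finite_depth F -> 0 <= c -> mean (fun x =>
  F x ^+ 2) <= c ^+ 2 ->
  mean_norm F <= c.
Proof.
move=> f c0 h; rewrite -(@ler_pXn2r _ 2) ?nnegrE ?mean_norm_ge0//; apply: le_trans h.
set a := mean_norm F.
have fF := fin_norm f; have fF2 := finX 2 f.
have : 0 <= mean (fun x => F x ^+ 2 + (- (2 * a) * `|F x| + a ^+ 2)).
  rewrite -(mean_cst 0); apply: mean_le; first exact: fin_cst.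
    by do !apply: finD => //; [apply: finM => //|]; exact: fin_cst.
  move=> x; rewrite (_ : _ + _ = (`|F x| - a) ^+ 2) ?sqr_ge0//.
  by rewrite -(real_normK (num_real (F x))); ring.
rewrite meanD//; last by apply: finD; [apply: finM => //|]; exact: fin_cst.
rewrite meanD; [|by apply: finM => //; exact: fin_cst|exact: fin_cst].
rewrite meanZ// mean_cst -/(mean_norm F) -/a; lra.
Qed.

End Expectation.

Ltac fin_tac := repeat first
  [ assumption | apply: fin_cst | apply: fin_rad | apply: finD | apply: finM
  | apply: finN | apply: fin_norm | apply: finX | (apply: fin_big => ?) ].

(** * Walsh functions of the digits *)

Section Walsh.
Context {R : realType}.
Implicit Types (F G H : (nat -> bool) -> R) (x y : nat -> bool) (c d : seq R).

Definition W n x : R := \prod_(k < n | odd (n %/ 2 ^ k)) rad k x.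

Lemma odd_divn_expn n k m : (n < 2 ^ m)%N -> odd (n %/ 2 ^ k) -> (k < m)%N.
Proof.
move=> nm; case: ltnP => // mk; rewrite divn_small//.
by apply: (leq_trans nm); rewrite leq_exp2l.
Qed.

Lemma W_widen n m x : (n < 2 ^ m)%N ->
  W n x = \prod_(k < m | odd (n %/ 2 ^ k)) rad k x.
Proof.
move=> nm; have nn : (n < 2 ^ n)%N by exact: ltn_expl.
rewrite /W (big_ord_widen_cond (maxn n m)%N
  (fun k => odd (n %/ 2 ^ k)) (fun k => rad k x)) ?leq_maxl//.
rewrite [RHS](big_ord_widen_cond (maxn n m)%N
  (fun k => odd (n %/ 2 ^ k)) (fun k => rad k x)) ?leq_maxr//.
apply: eq_bigl => k; case: (boolP (odd _)) => //= o.
by rewrite (odd_divn_expn nn o) (odd_divn_expn nm o).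
Qed.

Lemma W0 x : W 0 x = 1. Proof. by rewrite /W big_ord0. Qed.

Lemma W_add t j x : (j < 2 ^ t)%N -> W (2 ^ t + j) x = rad t x * W j x.
Proof.
move=> jt; rewrite (W_widen (m := t.+1)); last by rewrite expnS mul2n -addnn ltn_add2l.
rewrite big_mkcond big_ord_recr/= -big_mkcond/=.
rewrite divnDl ?dvdnn// divnn expn_gt0/= divn_small//= mulrC; congr (_ * _).
rewrite (W_widen x jt); apply: eq_bigl => k.
have kt := ltn_ord k.
rewrite divnDl ?dvdn_exp2l ?(ltnW kt)// oddD -expnB ?(ltnW kt)//.
by rewrite oddX subn_eq0 leqNgt kt.
Qed.

Lemma dep_W t j : (j < 2 ^ t)%N -> depends_on t (W j).
Proof.
move=> jt x y e; rewrite !(W_widen _ jt); apply: eq_bigr => k _.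
by rewrite /rad e.
Qed.

Lemma fin_W j : finite_depth (W j).
Proof. by exists j; apply: dep_W; exact: ltn_expl. Qed.

Lemma rad_sqr k x : rad k x * rad k x = 1 :> R.
Proof. by rewrite /rad -expr2 sqrr_sign. Qed.

Lemma rad_norm k x : `|rad k x| = 1 :> R.
Proof. by rewrite /rad normrX normrN1 expr1n. Qed.

(** Induction on the leading digit of the indices. If only one of them has it, a factor [rad n]
    survives and the mean is 0; if both have it, its square disappears and the remainders are
    compared. *)
Lemma mean_WW n j k : (j < 2 ^ n)%N -> (k < 2 ^ n)%N ->
  mean (fun x => W j x * W k x) = (j == k)%:R.
Proof.
elim: n j k => [|n IH] j k.
  rewrite expn0 !ltnS !leqn0 => /eqP-> /eqP->.
  by rewrite -[RHS](mean_cst 1); congr mean; apply/funext => x; rewrite W0 mulr1.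
rewrite expnS mul2n -addnn => jn kn.
case: (ltnP j (2 ^ n)%N) => j1; case: (ltnP k (2 ^ n)%N) => k1.
- exact: IH.
- rewrite -(subnKC k1) in kn *; move: (k - _)%N kn => k' {k1}.
  rewrite ltn_add2l => k1; rewrite (_ : (j == _) = false); last first.
    by apply/negbTE; rewrite ltn_eqF// ltn_addr.
  rewrite -[RHS](@mean_rad0 _ n (fun x => W j x * W k' x)).
    by congr mean; apply/funext => x; rewrite W_add//; ring.
  by apply: dep2; exact: dep_W.
- rewrite -(subnKC j1) in jn *; move: (j - _)%N jn => j' {j1}.
  rewrite ltn_add2l => j1; rewrite (_ : (_ == k) = false); last first.
    by apply/negbTE; rewrite gtn_eqF// ltn_addr.
  rewrite -[RHS](@mean_rad0 _ n (fun x => W j' x * W k x)).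
    by congr mean; apply/funext => x; rewrite W_add//; ring.
  by apply: dep2; exact: dep_W.
- rewrite -(subnKC k1) in kn *; move: (k - _)%N kn => k' {k1}.
  rewrite -(subnKC j1) in jn *; move: (j - _)%N jn => j' {j1}.
  rewrite !ltn_add2l eqn_add2l => jn kn; rewrite -(IH j' k')//.
  congr mean; apply/funext => x; rewrite !W_add//.
  by rewrite mulrACA rad_sqr mul1r.
Qed.

Definition wsum N c x : R := \sum_(i < size c) c`_i * W (N + i) x.

Lemma fin_wsum N c : finite_depth (wsum N c).
Proof.
by apply: fin_big => i; apply: finM; [exact: fin_cst|exact: fin_W].
Qed.

Lemma wsum_nil N x : wsum N [::] x = 0. Proof. by rewrite /wsum big_ord0. Qed.

Lemma wsum_cat N c d x :
  wsum N (c ++ d) x = wsum N c x + wsum (N + size c) d x.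
Proof.
rewrite /wsum size_cat big_split_ord/=; congr (_ + _).
  by apply: eq_bigr => i _; rewrite nth_cat ltn_ord.
by apply: eq_bigr => i _; rewrite nth_cat ltnNge leq_addr/= addKn addnA.
Qed.

Lemma mean_wsum2 N c : mean (fun x => wsum N c x ^+ 2) = \sum_(i < size c) c`_i ^+ 2.
Proof.
have [n hn] : exists n, forall i, (i < size c)%N -> (N + i < 2 ^ n)%N.
  exists (N + size c)%N => i ic; apply: ltn_trans (ltn_expl _ _) => //.
  by rewrite ltn_add2l.
transitivity (mean (fun x => \sum_(i < size c) \sum_(j < size c)
    (c`_i * c`_j) * (W (N + i) x * W (N + j) x))).
  congr mean; apply/funext => x; rewrite expr2 /wsum mulr_suml.
  apply: eq_bigr => i _; rewrite mulr_sumr; apply: eq_bigr => j _; ring.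
have fW i j : finite_depth (fun x => c`_i * c`_j * (W (N + i) x * W (N + j) x)).
  by apply: finM; [exact: fin_cst|apply: finM; exact: fin_W].
rewrite mean_bigsum; last by move=> i; apply: fin_big => j; exact: fW.
apply: eq_bigr => i _; rewrite mean_bigsum//.
rewrite (bigD1 i)//= big1 => [|j ji].
  rewrite meanZ ?(@mean_WW n) ?hn// ?eqxx ?addr0 ?mulr1//.
  by apply: finM; exact: fin_W.
rewrite meanZ ?(@mean_WW n) ?hn//; last by apply: finM; exact: fin_W.
by rewrite eqn_add2l eq_sym (_ : (_ == _ :> nat) = false) ?mulr0//; apply/negbTE.
Qed.

(** Parseval and Cauchy-Schwarz. Only the number and the moduli of the coefficients enter, so one
    bound serves every truncation and every choice of signs. *)
Lemma mean_norm_wsum N c (b e : R) K : (size c <= K)%N -> {in c, forall a, `|a| <= b} ->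
  0 <= e -> b ^+ 2 * K%:R <= e ^+ 2 -> mean_norm (wsum N c) <= e.
Proof.
move=> cK cb e0 be; apply: mean_norm_sqr => //; first exact: fin_wsum.
rewrite mean_wsum2; apply: le_trans be.
apply: (@le_trans _ _ (\sum_(i < size c) b ^+ 2)).
  apply: ler_sum => i _; have h := cb _ (mem_nth 0 (ltn_ord i)).
  by rewrite -real_normK ?num_real// ler_pXn2r// nnegrE// (le_trans _ h).
by rewrite sumr_const card_ord -[X in X <= _]mulr_natr ler_wpM2l ?sqr_ge0// ler_nat.
Qed.

Definition dker n x : R := \sum_(j < 2 ^ n) W j x.

Lemma dkerS n x : dker n.+1 x = dker n x + dker n x * rad n x.
Proof.
rewrite /dker expnS mul2n -addnn big_split_ord/=; congr (_ + _).
by rewrite mulr_suml; apply: eq_bigr => i _; rewrite W_add// mulrC.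
Qed.

Lemma dep_dker n : depends_on n (dker n).
Proof.
by apply: dep_big => i _; exact: dep_W.
Qed.

Lemma fin_dker n : finite_depth (dker n). Proof. by exists n; exact: dep_dker. Qed.

(** By [dkerS] each new digit either doubles the kernel or kills it. So the kernel is nonnegative,
    and its norm is its mean, which [mean_rad0] leaves unchanged. *)
Lemma mean_norm_dker n : mean_norm (dker n) = 1.
Proof.
suff [h h1] : (forall x, 0 <= dker n x) /\ mean (dker n) = 1.
  by rewrite -[RHS]h1; congr mean; apply/funext => x; rewrite ger0_norm.
elim: n => [|n [h h1]].
  split => [x|]; first by rewrite /dker expn0 big_ord1 W0.
  by rewrite -[RHS](mean_cst 1); congr mean; apply/funext =>
    x; rewrite /dker expn0 big_ord1 W0.
split => [x|].
  rewrite dkerS -{1}[dker n x]mulr1 -mulrDr mulr_ge0// /rad.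
  by case: (x n); rewrite ?expr0 ?expr1; lra.
have -> : dker n.+1 = fun x => dker n x + dker n x * rad n x.
  by apply/funext => x; rewrite dkerS.
rewrite meanD ?mean_rad0 ?addr0//; [exact: dep_dker|exact: fin_dker|].
by apply: finM; [exact: fin_dker|exact: fin_rad].
Qed.

(** All 2^s indices are occupied, so once the spectrum is shifted the only gap to be filled lies
    below it. The sign is a boolean exponent, which keeps the moduli exactly equal. *)
Definition flat s F (b : R) :=
  exists e : nat -> bool, forall x, F x = b * \sum_(j < 2 ^ s) (-1) ^+ e j * W j x.

Lemma flat_dep s F b : flat s F b -> depends_on s F.
Proof.
move=> [e h] x y xy; rewrite !h; congr (_ * _); apply: eq_bigr => i _.
by rewrite (dep_W (ltn_ord i) xy).
Qed.

Lemma flat_dbl s F G b : flat s F b -> flat s G b ->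
  flat s.+1 (fun x => F x + rad s x * G x) b.
Proof.
move=> [e f] [e' g]; exists (fun j => if (j < 2 ^ s)%N then e j else e' (j - 2 ^ s)%N) => x.
rewrite f g expnS mul2n -addnn big_split_ord/= mulrDr; congr (_ + _).
  by congr (_ * _); apply: eq_bigr => i _; rewrite ltn_ord.
rewrite mulrCA; congr (_ * _); rewrite mulr_sumr; apply: eq_bigr => i _.
by rewrite ltnNge leq_addr/= addKn W_add//; ring.
Qed.

Lemma flat_scale s F b (a : R) : flat s F b -> flat s (fun x => a * F x) (a * b).
Proof. by move=> [e h]; exists e => x; rewrite h mulrA. Qed.

Lemma flat_sign s F b (u : bool) : flat s F b -> flat s (fun x => (-1) ^+ u * F x) b.
Proof.
move=> [e h]; exists (fun j => u (+) e j) => x; rewrite h mulrCA mulr_sumr.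
by congr (_ * _); apply: eq_bigr => i _; rewrite signr_addb mulrA.
Qed.

Lemma flat_eq s F G b : (forall x, F x = G x) -> flat s F b -> flat s G b.
Proof. by move=> e; rewrite (_ : F = G)//; apply/funext. Qed.

Definition cyl m (w : nat -> bool) x : R := \prod_(i < m) ((1 + rad i w * rad i x) / 2).

Lemma cylS m w x : cyl m.+1 w x = cyl m w x * ((1 + rad m w * rad m x) / 2).
Proof. by rewrite /cyl big_ord_recr. Qed.

Lemma flat_cyl m w : flat m (cyl m w) (2 ^- m).
Proof.
elim: m => [|m IH].
  exists (fun=> false) => x.
  by rewrite /cyl big_ord0 expn0 big_ord1 W0 expr0 invr1 !mulr1.
have h := flat_scale 2^-1 IH.
have := flat_dbl h (flat_sign (w m) h).
rewrite -invfM -exprS; apply: flat_eq => x; rewrite cylS /rad.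
ring.
Qed.

Lemma cyl_E m w x : cyl m w x = [forall i : 'I_m, w i == x i]%:R.
Proof.
rewrite /cyl; case: forallP => h.
  rewrite big1// => i _; rewrite /rad -(eqP (h i)) -expr2 sqrr_sign; lra.
apply/eqP; rewrite prodf_seq_eq0; apply/hasP.
have [i /negP hi] : exists i : 'I_m, ~ (w i == x i).
  by apply/existsNP => h'; apply: h => i; exact: h'.
exists i; first exact: mem_index_enum.
move: hi; rewrite /rad/=; case: (w i); case: (x i) => // _;
  by rewrite expr0 expr1 ?mulr1 ?mul1r subrr mul0r.
Qed.

(* The factor is a bent function of two digits: it takes the values 1 and -1
   and its four Walsh coefficients all have modulus 1/2. *)
Lemma flat_bent s F b : flat s F b ->
  flat s.+2 (fun x => F x * ((1 + rad s x + rad s.+1 x - rad s x * rad s.+1 x) / 2)) (b / 2).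
Proof.
move=> h; rewrite [b / 2]mulrC.
have hf := flat_scale 2^-1 h.
have hX := flat_dbl hf hf; have hY := flat_dbl hf (flat_sign true hf).
by apply: flat_eq (flat_dbl hX hY) => x; rewrite expr1; ring.
Qed.

(** Each bent factor uses two new digits and halves the modulus of the coefficients, while |F| is
    unchanged. Thus b can be divided by any power of 2 at the cost of more frequencies. *)
Lemma flat_unimodular s F b r : flat s F b ->
  exists B, [/\ depends_on (s + r.*2) B, forall x, `|B x| = 1 &
    flat (s + r.*2) (fun x => F x * B x) (b / 2 ^+ r)].
Proof.
move=> h; elim: r => [|r [B [dB B1 fB]]].
  exists (fun=> 1); split => //; first by move=> x; rewrite normr1.
  by rewrite addn0 expr0 divr1; apply: flat_eq h => x; rewrite mulr1.
set t := (s + r.*2)%N in dB fB *; rewrite doubleS !addnS -/t.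
exists (fun x => B x * ((1 + rad t x + rad t.+1 x - rad t x * rad t.+1 x) / 2)); split.
- apply: dep2; first by apply: dep_le dB; rewrite ltnW.
  move=> x y e; rewrite (@dep_rad _ t.+2 t _ x y)// (@dep_rad _ t.+2 t.+1 _ x y)//.
- move=> x; rewrite normrM B1 mul1r /rad.
  case: (x t); case: (x t.+1); rewrite !(expr0, expr1).
  + by rewrite (_ : _ / 2 = -1) ?normrN1//; lra.
  + by rewrite (_ : _ / 2 = 1) ?normr1//; lra.
  + by rewrite (_ : _ / 2 = 1) ?normr1//; lra.
  + by rewrite (_ : _ / 2 = 1) ?normr1//; lra.
- have := flat_bent fB; rewrite (_ : b / 2 ^+ r.+1 = b / 2 ^+ r / 2); last first.
    by rewrite exprS invfM [2^-1 * _]mulrC mulrA.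
  by apply: flat_eq => x; rewrite -!mulrA.
Qed.

End Walsh.

(** * Blocks of coefficients *)

Section Runs.
Context {R : realType}.
Notation fn := ((nat -> bool) -> R).
Implicit Types (F G f u A B : fn) (x y w : nat -> bool) (c : seq R).

(** Nonvanishing is included because every coefficient must have a sign 1 or -1, and because the
    next block has to start below a positive modulus. *)
Definition dominates (a b : R) := (b != 0) && (`|b| <= `|a|).

(* [A] is the indicator function of a set which fills a proportion 2^-nu of each
   dyadic interval of rank [n]. *)
Definition splits n nu A :=
  [/\ finite_depth A, forall x, A x = 0 \/ A x = 1 &
      forall F, depends_on n F -> mean (fun x => F x * A x) = 2 ^- nu * mean F].

(* At any rank [s0] and below any modulus [b0] there is a block [c] of
   coefficients for the indices in [2^s0, 2^s1), nonincreasing in modulus, whose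
   Walsh sum is [q A] up to [e] and whose partial sums are related to [A] by [V]
   up to [eta + e], while the same sums with all signs positive are small. The set
   [A], subject to [S], is only known after the block has been chosen. *)
Definition run (S : fn -> Prop) (q : fn -> fn) (eta : R) (V : fn -> fn -> Prop) :=
  forall (s0 : nat) (b0 e : R), b0 != 0 -> 0 < e -> exists s1 c A,
   [/\ (s0 <= s1)%N, size c = (2 ^ s1 - 2 ^ s0)%N, path dominates b0 c & S A] /\
   [/\ mean_norm (wsum (2 ^ s0) (map Num.norm c)) <= e,
       mean_norm (fun x => wsum (2 ^ s0) c x - q A x) <= e,
       forall k, mean_norm (wsum (2 ^ s0) (map Num.norm (take k c))) <= eta + e &
       forall k, exists u, [/\ finite_depth u, V A u &
         mean_norm (fun x => wsum (2 ^ s0) (take k c) x - u x) <= eta + e]].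

Lemma run_weaken (S S' : fn -> Prop) (q q' : fn -> fn) (eta eta' : R)
    (V V' : fn -> fn -> Prop) :
  eta <= eta' -> (forall A, S A -> S' A /\ q A = q' A) ->
  (forall A u, S A -> finite_depth u -> V A u -> V' A u) -> run S q eta V ->
    run S' q' eta' V'.
Proof.
move=> ee Sq VV h s0 b0 e b00 e0.
have [s1 [c [A [[h1 h2 h3 SA] [h4 h5 h6 h7]]]]] := h s0 b0 e b00 e0.
have [S'A qA] := Sq _ SA.
exists s1, c, A; split; split => //.
- by rewrite -qA.
- by move=> k; rewrite (le_trans (h6 k))// lerD2r.
- move=> k; have [u [u1 u2 u3]] := h7 k; exists u; split => //; first exact: VV.
  by rewrite (le_trans u3)// lerD2r.
Qed.

(** Comparison functions that are small in norm can be replaced by 0 at the expense of the tolerance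
    for truncated sums, which is the form that [run_tree] asks for on a single interval. *)
Lemma run_absorb (S : fn -> Prop) (q : fn -> fn) (eta eta' : R)
    (V : fn -> fn -> Prop) : 0 <= eta' ->
  (forall A u, S A -> finite_depth u -> V A u -> mean_norm u <= eta') ->
  run S q eta V -> run S q (eta + eta') (fun _ u => u = fun=> 0).
Proof.
move=> ee VV h s0 b0 e b00 e0.
have [s1 [c [A [[h1 h2 h3 SA] [h4 h5 h6 h7]]]]] := h s0 b0 e b00 e0.
exists s1, c, A; split; split => //.
- by move=> k; rewrite (le_trans (h6 k))// addrAC lerDl.
- move=> k; have [u [u1 u2 u3]] := h7 k; exists (fun=> 0); split => //; first exact:
  fin_cst.
  have fw := @fin_wsum R (2 ^ s0) (take k c).
  rewrite addrAC; apply: le_trans (lerD u3 (VV _ _ SA u1 u2)).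
  apply: le_trans (mean_normD _ u1); last by apply: finD => //; exact: finN.
  by apply: mean_norm_le => [||x]; [fin_tac; exact: fin_wsum..|rewrite subr0 subrK].
Qed.

Lemma run_nil (S : fn -> Prop) (q : fn -> fn) (eta : R) (V : fn -> fn -> Prop) A :
  0 <= eta -> S A -> (forall x, q A x = 0) -> V A (fun=> 0) -> run S q eta V.
Proof.
move=> eta0 SA q0 VA s0 b0 e b00 e0; exists s0, [::], A.
have h0 G : (forall x, G x = 0) -> mean_norm G = 0.
  move=> G0; rewrite -[RHS](mean_cst 0); congr mean; apply/funext => x.
  by rewrite G0 normr0.
have w0 x : wsum (2 ^ s0) [::] x = 0 :> R by exact: wsum_nil.
split; split => //.
- by rewrite subnn.
- by rewrite h0 ?ltW.
- by rewrite h0 ?ltW// => x; rewrite w0 q0 subr0.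
- by move=> k /=; rewrite h0// addr_ge0// ltW.
- move=> k; exists (fun=> 0); split => //; first exact: fin_cst.
  by rewrite h0 ?addr_ge0 ?(ltW e0)// => x; rewrite w0 subr0.
Qed.

Lemma path_dominates_last b0 c : b0 != 0 -> path dominates b0 c -> last b0 c != 0.
Proof. by elim: c b0 => //= a c IH b0 _ /andP[/andP[a0 _]]; exact: IH. Qed.

(** Concatenation of two blocks. A truncation cuts only one of them, the other being absent or
    complete, so [eta] is not doubled; only the errors of complete sums add up, and these are halved
    beforehand. The data of the second block depend on [A], since a later round is built on the set
    left over by an earlier one. *)
Lemma run_seq (S0 : fn -> Prop) (q0 : fn -> fn) (V0 : fn -> fn -> Prop)
    (S1 : fn -> fn -> Prop) (q1 : fn -> fn -> fn) (V1 : fn -> fn -> fn -> Prop)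
    (comb : fn -> fn -> fn) (S : fn -> Prop) (q : fn -> fn) (eta : R)
    (V : fn -> fn -> Prop) : 0 <= eta ->
  run S0 q0 eta V0 -> (forall A, S0 A -> run (S1 A) (q1 A) eta (V1 A)) ->
  (forall A, S0 A -> finite_depth (q0 A)) -> (forall A B, S0 A -> S1 A B ->
    finite_depth (q1 A B)) ->
  (forall A B, S0 A -> S1 A B -> S (comb A B)) ->
  (forall A B x, S0 A -> S1 A B -> q0 A x + q1 A B x = q (comb A B) x) ->
  (forall A B u, S0 A -> S1 A B -> finite_depth u -> V0 A u -> V (comb A B) u) ->
  (forall A B u, S0 A -> S1 A B -> finite_depth u -> V1 A B u ->
     V (comb A B) (fun x => q0 A x + u x)) ->
  run S q eta V.
Proof.
move=> eta0 h0 h1 fq0 fq1 HS Hq HV0 HV1 s0 b0 e b00 e0.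
have e20 : 0 < e / 2 by rewrite divr_gt0.
have ee : e = e / 2 + e / 2 by rewrite -splitr.
have [s1 [c [A [[c1 c2 c3 SA] [c4 c5 c6 c7]]]]] := h0 s0 b0 _ b00 e20.
have [s2 [d [B [[d1 d2 d3 SB] [d4 d5 d6 d7]]]]] :=
  h1 A SA s1 _ _ (path_dominates_last b00 c3) e20.
have sc : (2 ^ s0 + size c = 2 ^ s1)%N by rewrite c2 subnKC// leq_exp2l.
have fw N l : finite_depth (wsum N l : fn) by exact: fin_wsum.
have fA := fq0 _ SA; have fB := fq1 _ _ SA SB.
have wD N l l' : wsum N (l ++ l') = fun x => wsum N l x + wsum (N + size l) l' x :> R.
  by apply/funext => x; rewrite wsum_cat.
exists s2, (c ++ d), (comb A B); split; split => //.
- exact: leq_trans d1.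
- by rewrite size_cat c2 d2 addnC addnBA ?leq_exp2l// subnK// leq_exp2l.
- by rewrite cat_path c3 d3.
- exact: HS.
- rewrite map_cat wD size_map sc; apply: (le_trans (mean_normD _ _)) => //.
  by rewrite ee lerD.
- rewrite wD sc ee; apply: le_trans (lerD c5 d5).
  apply: le_trans (mean_normD _ _); [|by fin_tac..].
  apply: mean_norm_le => [||x].
  + have -> : q (comb A B) = fun x => q0 A x + q1 A B x by apply/funext => x; rewrite Hq.
    by fin_tac.
  + by fin_tac.
  + by rewrite -Hq// opprD addrACA.
- move=> k; rewrite take_cat; case: ifPn => kc.
    by rewrite (le_trans (c6 k))// lerD2l {2}ee lerDl ltW.
  rewrite map_cat wD size_map sc; apply: (le_trans (mean_normD _ _)) => //.
  by rewrite ee addrCA lerD.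
- move=> k; rewrite take_cat; case: ifPn => kc.
    have [u [u1 u2 u3]] := c7 k; exists u; split => //; first exact: HV0.
    by rewrite (le_trans u3)// lerD2l {2}ee lerDl ltW.
  have [u [u1 u2 u3]] := d7 (k - size c)%N.
  exists (fun x => q0 A x + u x); split => //; [by fin_tac|exact: HV1|].
  rewrite wD sc ee addrCA; apply: le_trans (lerD c5 u3).
  apply: le_trans (mean_normD _ _); [|by fin_tac..].
  by apply: mean_norm_le => [||x]; [fin_tac..|rewrite opprD addrACA].
Qed.

Lemma spl_le m n nu A : (n <= m)%N -> splits m nu A -> splits n nu A.
Proof. by move=> nm [h1 h2 h3]; split => // F dF; apply: h3; exact: dep_le dF. Qed.

Definition glue k A B : fn := fun x => if x k then B x else A x.

Lemma mixE k A B : glue k A B =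
  fun x => A x * ((1 + rad k x) / 2) + B x * ((1 - rad k x) / 2).
Proof.
by apply/funext => x; rewrite /glue /rad; case: (x k); rewrite ?expr0 ?expr1; lra.
Qed.

Lemma spl_mix n nu k A B : (k < n)%N -> splits n nu A -> splits n nu B ->
  splits n nu (glue k A B).
Proof.
move=> kn [A1 A2 A3] [B1 B2 B3]; split.
- by rewrite mixE; fin_tac.
- by move=> x; rewrite /glue; case: (x k).
- move=> F dF; pose p (t : R) F' : fn := fun x => F' x * ((1 + t * rad k x) / 2).
  have dp t : depends_on n (p t F).
    by apply: dep2 => //; apply: (dep1 (fun a => (1 + t * a) / 2)); exact: dep_rad.
  have fp t : finite_depth (p t F) by exists n.
  transitivity (mean (fun x => p 1 F x * A x + p (-1) F x * B x)).
    by congr mean; apply/funext => x; rewrite mixE /p; ring.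
  rewrite (meanD (finM (fp _) A1) (finM (fp _) B1)).
  rewrite A3// B3// -mulrDr -meanD//; congr (_ * mean _); apply/funext => x.
  by rewrite /p; field.
Qed.

(** Truncated sums must be compared with the target pointwise: the large factor 2^nu is tolerable
    only on [A], where the weight will be small, and a bound in norm would not tell where it
    acts. *)
Definition dominated nu f A u := forall x, `|u x| <=
  `|f x| * (1 - A x) + 2 ^+ nu * `|f x| * A x.

Lemma dep_cyl m w : depends_on m (cyl m w : fn).
Proof. exact: flat_dep (flat_cyl m w). Qed.

Lemma fin_cyl m w : finite_depth (cyl m w : fn).
Proof. by exists m; exact: dep_cyl. Qed.

Definition set_digit w k b : nat -> bool := fun i => if i == k then b else w i.

Lemma cyl_upd k w b x :
  cyl k.+1 (set_digit w k b) x = cyl k w x * ((1 + (-1) ^+ b * rad k x) / 2) :> R.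
Proof.
rewrite cylS; congr (_ * _); last by rewrite /rad /set_digit eqxx.
apply: eq_bigr => i _; by rewrite /rad /set_digit ltn_eqF.
Qed.

(* Recursion over the binary tree of the dyadic intervals: a block for [f] is the
   concatenation of blocks for its restrictions to the intervals of rank [m]. *)
Lemma run_tree n m nu f eta : (n <= m)%N -> depends_on n f -> 0 <= eta ->
  (forall w, run (splits m nu) (fun A x => f x * cyl m w x * (1 - 2 ^+ nu * A x)) eta
     (fun _ u => u = fun=> 0)) ->
  run (splits m nu) (fun A x => f x * (1 - 2 ^+ nu * A x)) eta (dominated nu f).
Proof.
move=> nm df eta0 h.
have ff : finite_depth f by exists n.
have fc k w : finite_depth (cyl k w : fn) by exact: fin_cyl.
(* The induction climbs from single intervals of rank m (d = 0) to the whole of [0, 1) (d = m),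
   joining two halves at each step. *)
suff key d : (d <= m)%N -> forall w, run (splits m nu)
    (fun A x => (f x * cyl (m - d) w x) * (1 - 2 ^+ nu * A x)) eta
    (dominated nu (fun x => f x * cyl (m - d) w x)).
  have := key m (leqnn m) xpred0; rewrite subnn.
  have -> : (fun x => f x * cyl 0 xpred0 x) = f.
    by apply/funext => x; rewrite /cyl big_ord0 mulr1.
  by apply: run_weaken => // A SA; split => //; apply/funext =>
    x; rewrite /cyl big_ord0 mulr1.
elim: d => [_ w|d IH dm w].
  rewrite subn0; apply: run_weaken (h w) => // A u [_ A01 _] _ -> x.
  rewrite normr0 addr_ge0// mulr_ge0// ?mulr_ge0// ?exprn_ge0//;
  by case: (A01 x) => ->; rewrite ?subr0 ?subrr.
set k := (m - d.+1)%N; have km : (k < m)%N by rewrite /k ltn_subrL/= (leq_ltn_trans _ dm).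
have kd : (m - d)%N = k.+1 by rewrite /k subnSK.
have {}IH := IH (ltnW dm); rewrite kd in IH.
have fA (A : fn) : splits m nu A -> finite_depth A by case.
have cE b x : cyl k.+1 (set_digit w k b) x = cyl k w x * (x k == b)%:R :> R.
  rewrite cyl_upd /rad; case: b; case: (x k); rewrite !(expr0, expr1)/=; congr (_ * _); lra.
apply: (run_seq eta0 (comb := glue k) (S1 := fun=> splits m nu) (IH (set_digit w k false))
   (fun _ _ => IH (set_digit w k true))).
- by move=> A /fA ?; fin_tac.
- by move=> A B /fA ? /fA ?; fin_tac.
- by move=> A B SA SB; exact: spl_mix.
- move=> A B x _ _; rewrite !cE /glue; case: (x k) => /=; ring.
- move=> A B u SA SB _ hu x; have := hu x; rewrite !cE /glue; case: (x k) => /=.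
    rewrite !mulr0 normr0 !(mulr0, mul0r) addr0 => /le_trans; apply.
    have [_ B01 _] := SB.
    rewrite addr_ge0// mulr_ge0// ?mulr_ge0// ?exprn_ge0//;
    by case: (B01 x) => ->; rewrite ?subr0 ?subrr.
  by rewrite mulr1.
- move=> A B u SA SB _ hu x; have := hu x; rewrite !cE /glue; case: (x k) => /=.
    by rewrite !mulr0 mul0r add0r mulr1.
  rewrite !mulr0 normr0 !(mulr0, mul0r) addr0 normr_le0 => /eqP->.
  rewrite mulr1 addr0 normrM; have [_ A01 _] := SA.
  case: (A01 x) => ->; first by rewrite !(mulr0, subr0, mulr1, addr0) normr1 mulr1.
  rewrite subrr !mulr1 mulr0 add0r mulrC ler_wpM2r//.
  have : 1 <= 2 ^+ nu :> R by rewrite exprn_ege1// ler1n.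
  by move=> h1; rewrite ler_norml; apply/andP; split; lra.
Qed.

End Runs.

(** * Blocks for one interval, one round and one target *)

Section Stage.
Context {R : realType}.
Notation fn := ((nat -> bool) -> R).
Implicit Types (F G f u A B : fn) (x y w : nat -> bool) (c : seq R).

Lemma small_geo (a e : R) : 0 <= a -> 0 < e ->
  exists r0, forall r, (r0 <= r)%N -> a / 2 ^+ r <= e.
Proof.
move=> a0 e0; exists (Num.truncn (a / e)).+1 => r hr.
rewrite ler_pdivrMr ?exprn_gt0// mulrC -ler_pdivrMr//.
apply: le_trans (ltW (truncnS_gt _)) _.
rewrite -natrX ler_nat (leq_trans hr)// ltnW//; exact: ltn_expl.
Qed.

Lemma wsum_nseq s0 s (b : R) x : (s0 <= s)%N ->
  wsum (2 ^ s0) (nseq (2 ^ s - 2 ^ s0) b) x = b * (dker s x - dker s0 x).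
Proof.
move=> ss; have -> : dker s x = dker s0 x + \sum_(i < 2 ^ s - 2 ^ s0) W (2 ^ s0 + i) x :> R.
  have e : (2 ^ s0 <= 2 ^ s)%N by rewrite leq_exp2l.
  by rewrite /dker -[in LHS](subnKC e) big_split_ord.
rewrite addrAC subrr add0r /wsum size_nseq mulr_sumr.
by apply: eq_bigr => i _; rewrite nth_nseq ltn_ord.
Qed.

Lemma path_dominates_cst b0 c (b : R) : b != 0 -> `|b| <= `|b0| ->
  {in c, forall a, `|a| = `|b|} -> path dominates b0 c.
Proof.
move=> bn0; elim: c b0 => //= a c IH b0 bb h.
have ha : `|a| = `|b| by apply: h; rewrite mem_head.
rewrite /dominates ha bb andbT -normr_eq0 ha normr_eq0 bn0/=.
by apply: IH => [|a' a'c]; rewrite ?ha// h// in_cons a'c orbT.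
Qed.

Lemma unimodular01 (t : R) : `|t| = 1 -> (1 - t) / 2 = 0 \/ (1 - t) / 2 = 1.
Proof. by case: (ger0P t) => _ h; [left|right]; lra. Qed.

(** The digit s is not seen by [B] nor by functions of rank m, so the unimodular function
    [B * rad s] has mean zero against the latter: it is -1 on exactly half of each interval of rank
    m. *)
Lemma spl_atom m s B : (m <= s)%N -> depends_on s B -> (forall x, `|B x| = 1) ->
  splits m 1 (fun x => (1 - B x * rad s x) / 2).
Proof.
move=> ms dB B1.
have fB : finite_depth B by exists s.
split.
- by fin_tac.
- by move=> x; apply: unimodular01; rewrite normrM B1 rad_norm mulr1.
move=> F dF; have fF : finite_depth F by exists m.
transitivity (mean (fun x => 2^-1 * F x + - 2^-1 * ((F x * B x) * rad s x))).
  by congr mean; apply/funext => x; field.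
rewrite meanD; [|by fin_tac..].
rewrite !meanZ; [|by fin_tac..].
by rewrite mean_rad0 ?mulr0 ?addr0//; apply: dep2 => //; exact: dep_le dF.
Qed.

(* The coefficients of the block all have modulus |b|: the first part is filled up
   with positive coefficients and contributes [b] times a difference of Dirichlet
   kernels, the second part is [g * cyl m w] times a unimodular function. *)
Lemma run_atom m w (g eta : R) : g != 0 -> 0 <= eta -> 2 * g ^+ 2 / 2 ^+ m <= eta ^+ 2 ->
  run (splits m 1) (fun A x => g * cyl m w x * (1 - 2 ^+ 1 * A x)) eta
    (fun _ u => u = fun=> 0).
Proof.
move=> g0 eta0 heta s0 b0 e b00 e0.
have hb : 0 < Num.min `|b0| (e / 2) by rewrite lt_min normr_gt0 b00 divr_gt0.
have [r0 hr0] := @small_geo (`|g| / 2 ^+ m) _ (divr_ge0 (normr_ge0 g) (exprn_ge0 _ (ler0n _ 2))) hb.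
(* [r0] brings the modulus below both |b0| and e/2; r >= s0 ensures that the flat spectrum starts at
   or after the index 2^s0. *)
pose r := maxn r0 s0; have := hr0 r (leq_maxl _ _).
rewrite le_min => /andP[hr1 hr2].
pose s := (m + r.*2)%N.
have s0s : (s0 <= s)%N.
  by apply: (leq_trans (leq_maxr r0 s0)); rewrite /s -/r -addnn addnA leq_addl.
have [B [dB B1 [sg fB]]] := flat_unimodular r (flat_scale g (@flat_cyl R m w)).
set b : R := g * 2 ^- m / 2 ^+ r in fB.
have nb : `|b| = `|g| / 2 ^+ m / 2 ^+ r.
  by rewrite /b !normrM !normfV !normrX !normr_nat.
rewrite -nb in hr1 hr2.
have bn0 : b != 0 by rewrite /b !mulf_neq0// invr_neq0// expf_neq0.
pose c := nseq (2 ^ s - 2 ^ s0) `|b| ++ mkseq (fun j => b * (-1) ^+ sg j) (2 ^ s).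
have cb : {in c, forall a, `|a| = `|b|}.
  move=> a; rewrite mem_cat => /orP[/nseqP[->]|/mapP[j _ ->]]; first by rewrite normr_id.
  by rewrite normrM normrX normrN1 expr1n mulr1.
have sc : size c = (2 ^ s.+1 - 2 ^ s0)%N.
  rewrite size_cat size_nseq size_mkseq expnS mul2n -addnn.
  by rewrite addnC addnBA// leq_exp2l.
have leK : forall k, (size (take k c) <= 2 ^ s.+1)%N.
  by move=> k; rewrite size_take_min sc (leq_trans (geq_minr _ _))// leq_subr.
(* At most 2^(s+1) coefficients have modulus |g| 2^-m 2^-r, and s = m + 2r. So r cancels and the
   bound 2 g^2 2^-m depends on the rank of the interval alone. *)
have heta2 : `|b| ^+ 2 * (2 ^ s.+1)%:R <= eta ^+ 2.
  apply: le_trans heta; rewrite nb !exprMn real_normK ?num_real// natrX.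
  have p2 k : 2 ^+ k != 0 :> R by rewrite expf_neq0.
  have -> : 2 ^+ s.+1 = 2 * (2 ^+ m * (2 ^+ r * 2 ^+ r)) :> R.
    by rewrite exprS /s -addnn !exprD.
  rewrite le_eqVlt; apply/orP; left; apply/eqP; field.
  by rewrite !p2.
have key c' k : size c' = size c -> {in c', forall a, `|a| = `|b|} ->
    mean_norm (wsum (2 ^ s0) (take k c')) <= eta + e.
  move=> s' b'; apply: (@le_trans _ _ eta); last by rewrite lerDl ltW.
  apply: (@mean_norm_wsum _ _ _ `|b| _ (2 ^ s.+1)%N) => //.
    by move: (leK k); rewrite !size_take s'.
  by move=> a /mem_take /b' ->.
have fk t t' (a : R) : finite_depth (fun x => a * (dker t x - dker t' x)).
  by fin_tac; exact: fin_dker.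
have nk t t' : mean_norm (fun x => `|b| * (dker t x - dker t' x)) <= e.
  rewrite mean_normZ ?normr_id; last by fin_tac; exact: fin_dker.
  apply: (@le_trans _ _ (e / 2 * 2)); last by rewrite divfK.
  apply: ler_pM => //.
    by apply: mean_norm_ge0; fin_tac; exact: fin_dker.
  by apply: le_trans (mean_normB _ _) _; [exact: fin_dker..|rewrite !mean_norm_dker].
(* The exceptional set is where the factor [B * rad s] equals -1, so that 1 - 2A is this factor. *)
exists s.+1, c, (fun x => (1 - B x * rad s x) / 2); split; split => //.
- exact: leqW.
- exact: path_dominates_cst bn0 hr1 cb.
- by apply: spl_atom => //; rewrite leq_addr.
- have -> : map Num.norm c = nseq (2 ^ s.+1 - 2 ^ s0) `|b|.
    apply: (@eq_from_nth _ 0); rewrite size_map sc ?size_nseq// => i ic.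
    by rewrite (nth_map 0) ?sc// nth_nseq ic cb// mem_nth// sc.
  rewrite (_ : wsum _ _ = fun x => `|b| * (dker s.+1 x - dker s0 x)) ?nk//.
  by apply/funext => x; rewrite wsum_nseq// leqW.
- rewrite (_ : (fun x => _) = fun x => `|b| * (dker s x - dker s0 x)) ?nk//.
  apply/funext => x; rewrite wsum_cat wsum_nseq// size_nseq subnKC ?leq_exp2l//.
  have -> : wsum (2 ^ s) (mkseq (fun j => b * (-1) ^+ sg j) (2 ^ s)) x =
      rad s x * (g * cyl m w x * B x).
    rewrite fB /wsum size_mkseq -/s !mulr_sumr; apply: eq_bigr => i _.
    by rewrite nth_mkseq// W_add//; ring.
  by rewrite expr1; field.
- move=> k; rewrite map_take; apply: (key (map Num.norm c) k); rewrite ?size_map//.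
  by move=> a /mapP[a' /cb h ->]; rewrite normr_id.
- move=> k; exists (fun=> 0); split => //; first exact: fin_cst.
  rewrite (_ : (fun x => _) = wsum (2 ^ s0) (take k c)) ?key//.
  by apply/funext => x; rewrite subr0.
Qed.

Lemma fin_bounded f : finite_depth f -> exists2 M : R, 0 <= M & forall x, `|f x| <= M.
Proof.
move=> [n df].
pose ex (t : n.-tuple bool) : nat -> bool := nth false t.
exists (\sum_(t : n.-tuple bool) `|f (ex t)|); first exact: sumr_ge0.
move=> x; have -> : f x = f (ex (mktuple (fun i : 'I_n => x i))).
  by apply: df => k kn; rewrite /ex (nth_mktuple _ _ (Ordinal kn)).
rewrite (bigD1 (mktuple (fun i : 'I_n => x i)))//= lerDl.
exact: sumr_ge0.
Qed.

Lemma dep_cylE m f w x : depends_on m f -> f x * cyl m w x = f w * cyl m w x.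
Proof.
move=> df; rewrite cyl_E; case: forallP => h; last by rewrite !mulr0.
by rewrite (df x w)// => k km; have /eqP := h (Ordinal km).
Qed.

Lemma small_level (M eta : R) n : 0 < eta ->
  exists2 m, (n <= m)%N & M / 2 ^+ m <= eta.
Proof.
move=> eta0; have [r0 h] := small_geo (normr_ge0 M) eta0.
exists (maxn n r0); first exact: leq_maxl.
apply: le_trans (h _ (leq_maxr n r0)).
by rewrite ler_pM2r ?invr_gt0 ?exprn_gt0// ler_norm.
Qed.

Lemma run_round n f (eta : R) : depends_on n f -> 0 < eta ->
  run (splits n 1) (fun A x => f x * (1 - 2 ^+ 1 * A x)) eta (dominated 1 f).
Proof.
move=> df eta0.
have [M M0 fM] : exists2 M : R, 0 <= M & forall x, `|f x| <= M.
  by apply: fin_bounded; exists n.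
have [m nm hm] := small_level (2 * M ^+ 2) n (exprn_gt0 2 eta0).
have dmf : depends_on m f by exact: dep_le df.
suff : run (splits m 1) (fun A x => f x * (1 - 2 ^+ 1 * A x)) eta (dominated 1 f).
  by apply: run_weaken => // A SA; split => //; exact: spl_le SA.
apply: (run_tree nm df (ltW eta0)) => w.
(* On an interval where f vanishes the block is empty, since [run_atom] would produce zero
   coefficients. *)
have [fw|fw] := eqVneq (f w) 0.
  apply: (@run_nil _ _ _ _ _ (fun x => (1 - 1 * rad m x) / 2)) => //.
  - exact: ltW.
  - by apply: (@spl_atom m m (fun=> 1)) => // x; rewrite normr1.
  - by move=> x; rewrite dep_cylE// fw !mul0r.
apply: run_weaken (@run_atom m w _ _ fw (ltW eta0) _) => //.
  by move=> A SA; split => //; apply/funext => x; rewrite (dep_cylE _ _ dmf).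
apply: le_trans hm; rewrite ler_pM2r ?invr_gt0 ?exprn_gt0// ler_pM2l//.
by rewrite -[f w ^+ 2]real_normK ?num_real// ler_pXn2r// nnegrE.
Qed.

(* After [nu] rounds the sum is [f] off [A] and [f - 2^nu f] on [A]; the next round
   adds [2^nu f] times a random sign on [A], which repairs half of [A]. *)
Lemma run_rounds nu n f (eta : R) : depends_on n f -> 0 < eta ->
  run (splits n nu) (fun A x => f x * (1 - 2 ^+ nu * A x)) eta
    (fun _ u => mean_norm u <= 2 ^+ nu.+1 * mean_norm f).
Proof.
move=> df eta0; have ff : finite_depth f by exists n.
elim: nu => [|nu IH].
  apply: (@run_nil _ _ _ _ _ (fun=> 1)) => //; first exact: ltW.
  - split; [exact: fin_cst|by right|move=> F dF].
    by rewrite expr0 invr1 mul1r; congr mean; apply/funext => x; rewrite mulr1.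
  - by move=> x; rewrite expr0 mulr1 subrr mulr0.
  - by rewrite mean_norm_cst normr0 mulr_ge0 ?exprn_ge0// mean_norm_ge0.
(* The set left by the previous rounds involves digits of a rank not known in advance; the next
   round works at a rank N that resolves both it and f. *)
have hd (A : fn) : finite_depth A -> exists N,
    [/\ (n <= N)%N, depends_on N A & depends_on N (fun x => 2 ^+ nu * f x * A x)].
  move=> [a dA]; exists (maxn n a); split; first exact: leq_maxl.
    by apply: dep_le dA; exact: leq_maxr.
  apply: dep2; last by apply: dep_le dA; exact: leq_maxr.
  by apply: dep2 => //; apply: dep_le df; exact: leq_maxl.
have p1 : 1 <= 2 ^+ nu :> R by rewrite exprn_ege1// ler1n.
apply: (@run_seq _ _ _ _ (fun A B => exists N, [/\ depends_on N A, (n <= N)%N &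
  splits N 1 B])
  (fun A B x => 2 ^+ nu * f x * A x * (1 - 2 ^+ 1 * B x))
  (fun A B => dominated 1 (fun x => 2 ^+ nu * f x * A x) B)
  (fun A B x => A x * B x) _ _ _ _ (ltW eta0) IH).
- move=> A [fA _ _]; have [N [nN dA dN]] := hd _ fA.
  by apply: run_weaken (run_round dN eta0) => // B SB; split => //; exists N.
- by move=> A [fA _ _]; fin_tac.
- by move=> A B [fA _ _] [N [_ _ [fB _ _]]]; fin_tac.
- move=> A B [fA A01 hA] [N [dA nN [fB B01 hB]]]; split; first by fin_tac.
    by move=> x; case: (A01 x) => ->; case: (B01 x) =>
      ->; rewrite ?mulr0 ?mul0r ?mulr1; auto.
  move=> F dF; transitivity (mean (fun x => F x * A x * B x)).
    by congr mean; apply/funext => x; rewrite mulrA.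
  rewrite hB; last by apply: dep2 => //; exact: dep_le dF.
  by rewrite hA// mulrA -invfM -exprD.
- by move=> A B x _ _; rewrite expr1 exprS; ring.
- move=> A B u _ _ _ /le_trans; apply; rewrite ler_wpM2r ?mean_norm_ge0//.
  by rewrite ler_eXn2l// ltr1n.
- move=> A B u [fA A01 hA] [N [dA nN [fB B01 hB]]] fu hu.
  rewrite -[X in X * _]ger0_norm ?exprn_ge0// -mean_normZ//.
  apply: mean_norm_le => [||x]; [by fin_tac..|].
  apply: (le_trans (ler_normD _ _)).
  (* Off [A] this is |f|, on [A] it is (3 * 2^nu - 1) |f|; both are below 2^(nu+2) |f|. *)
  apply: (@le_trans _ _ (`|f x * (1 - 2 ^+ nu * A x)| + 2 * `|2 ^+ nu * f x * A x|)).
    rewrite lerD2l; apply: (le_trans (hu x)).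
    by case: (B01 x) => ->; rewrite expr1; have := normr_ge0 (2 ^+ nu * f x * A x); lra.
  rewrite !exprS; set p := 2 ^+ nu in p1 *; have f0 := normr_ge0 (f x).
  rewrite !normrM normr_nat (ger0_norm (le_trans ler01 p1)).
  case: (A01 x) => ->.
    rewrite !mulr0 subr0 normr0 normr1 !mulr0 mulr1 addr0 -[leLHS]mul1r ler_wpM2r//; lra.
  rewrite mulr1 normr1 mulr1 [`|1 - p|]ler0_norm; last by lra.
  by nra.
Qed.

Lemma mean_cyl m w : mean (cyl m w : fn) = 2 ^- m.
Proof.
elim: m => [|m IH].
  by rewrite expr0 invr1 -[RHS](mean_cst 1); congr mean; apply/funext =>
    x; rewrite /cyl big_ord0.
transitivity (mean (fun x => 2^-1 * cyl m w x + (2^-1 :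
  R) * rad m w * (cyl m w x * rad m x))).
  by congr mean; apply/funext => x; rewrite cylS; field.
have fc := @fin_cyl R m w.
rewrite meanD; [|by fin_tac..].
rewrite !meanZ; [|by fin_tac..].
by rewrite mean_rad0; [rewrite mulr0 addr0 IH -invfM exprS|exact: dep_cyl].
Qed.

(** The rounds may produce partial sums 2^(nu+1) times as large as the target. All rounds are
    therefore completed on one interval of rank m before the next interval is touched: the excess is
    then at most 2^(nu+1) M 2^-m, which is half of [eta] for large m. The other half is for
    truncations inside a round. *)
Lemma run_stage n nu f (eta : R) : depends_on n f -> 0 < eta ->
  run (splits n nu) (fun A x => f x * (1 - 2 ^+ nu * A x)) eta (dominated nu f).
Proof.
move=> df eta0; have ff : finite_depth f by exists n.
have [M M0 fM] := fin_bounded ff.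
have e20 : 0 < eta / 2 by rewrite divr_gt0.
have [m nm hm] := small_level (2 ^+ nu.+1 * M) n e20.
suff : run (splits m nu) (fun A x => f x * (1 - 2 ^+ nu * A x)) eta (dominated nu f).
  by apply: run_weaken => // A SA; split => //; exact: spl_le SA.
apply: (run_tree nm df (ltW eta0)) => w.
have fc := @fin_cyl R m w.
have dc : depends_on m (fun x => f x * cyl m w x).
  by apply: dep2; [exact: dep_le df|exact: dep_cyl].
rewrite [eta]splitr; apply: (run_absorb (ltW e20) _ (run_rounds nu dc e20)).
move=> A u _ _ /le_trans; apply; apply: le_trans hm.
rewrite -mulrA ler_pM2l ?exprn_gt0// -(mean_cyl m w) -meanZ//; apply:
  mean_le; [by fin_tac..|].
move=> x; rewrite normrM.
have c0 : 0 <= cyl m w x :> R by rewrite cyl_E ler0n.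
by rewrite (ger0_norm c0) ler_wpM2r.
Qed.

End Stage.

(** * Concatenation of the blocks into one coefficient sequence *)

Section Construction.
Context {R : realType}.
Notation fn := ((nat -> bool) -> R).
Implicit Types (F G f u A B : fn) (x y w : nat -> bool) (c L : seq R).

(** The length is a power of 2 because every block fills a range between powers of 2, which is what
    makes the Dirichlet kernels harmless. *)
Definition admissible L := (exists s, size L = (2 ^ s)%N) /\ path dominates 1 L.

Definition stage_spec nu f (e : R) (N : nat) c A :=
  [/\ finite_depth A, forall x, A x = 0 \/ A x = 1, mean A = 2 ^- nu &
      mean_norm (fun x => wsum N c x - f x * (1 - 2 ^+ nu * A x)) <= e] /\
  forall k, mean_norm (wsum N (map Num.norm (take k c))) <= e /\
    exists u, [/\ finite_depth u, dominated nu f A u & mean_norm (fun x =>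
      wsum N (take k c) x - u x) <= e].

(* A constant filler of length 2^s is put in front of the block, since a block for
   [f = 0] may be empty. *)
Lemma stage_exists nu f (e : R) L : finite_depth f -> 0 < e -> admissible L ->
  exists c A, [/\ (0 < size c)%N, admissible (L ++ c) & stage_spec nu f e (size L) c A].
Proof.
move=> ff e0 [[s sL] pL].
have l0 : last 1 L != 0 :> R by apply: path_dominates_last pL; exact: oner_neq0.
(* The filler has 2^s coefficients b, so its L^2 norm is at most b 2^s <= e/4, for every truncation
   as well. *)
pose b := Num.min `|last 1 L| (e / 4 / 2 ^+ s).
have p2 : 0 < 2 ^+ s :> R by rewrite exprn_gt0.
have e40 : 0 < e / 4 by rewrite divr_gt0.
have b0 : 0 < b by rewrite lt_min normr_gt0 l0 divr_gt0.
have bl : b <= `|last 1 L| by rewrite /b ge_min lexx.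
have be : b <= e / 4 / 2 ^+ s by rewrite /b ge_min lexx orbT.
pose d := nseq (2 ^ s) b.
have dN : map Num.norm d = d by rewrite map_nseq gtr0_norm.
have dk k : mean_norm (wsum (2 ^ s) (take k d)) <= e / 4.
  apply: (@mean_norm_wsum _ _ _ b _ (2 ^ s)%N).
  - by rewrite size_take_min size_nseq geq_minr.
  - by move=> a /mem_take /nseqP[-> _]; rewrite gtr0_norm.
  - exact: ltW.
  - have h : b * 2 ^+ s <= e / 4 by rewrite -ler_pdivlMr.
    have p1 : 1 <= 2 ^+ s :> R by rewrite exprn_ege1// ler1n.
    rewrite natrX; apply: (@le_trans _ _ ((b * 2 ^+ s) ^+ 2)).
      by rewrite exprMn ler_wpM2l ?sqr_ge0// ler_eXnr.
    by rewrite ler_pXn2r// nnegrE ?(ltW e40)// mulr_ge0// ltW.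
have [n df] := ff.
have e80 : 0 < e / 4 / 2 by rewrite divr_gt0.
have [s1 [c [A [[h1 h2 h3 [h4 h4' h4'']] [h5 h6 h7 h8]]]]] :=
  run_stage nu df e40 (s.+1) (lt0r_neq0 b0) e40.
have sd : (2 ^ s + size d = 2 ^ s.+1)%N by rewrite size_nseq expnS mul2n addnn.
have fw N l : finite_depth (wsum N l : fn) by exact: fin_wsum.
have wD l l' : wsum (2 ^ s) (l ++ l') =
    fun x => wsum (2 ^ s) l x + wsum (2 ^ s + size l) l' x :> R.
  by apply/funext => x; rewrite wsum_cat.
have dd : mean_norm (wsum (2 ^ s) d) <= e / 4.
  by have := dk (size d); rewrite take_size.
exists (d ++ c), A; split.
- by rewrite size_cat size_nseq addn_gt0 expn_gt0.
- split.
    exists s1; rewrite !size_cat sL addnA sd h2 subnKC// leq_exp2l//.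
  rewrite cat_path pL /= cat_path.
  have -> : last (last 1 L) d = b.
    by rewrite (last_nth 0) size_nseq -cat1s nth_cat/= ltnNge expn_gt0/=
      nth_nseq ltn_subrL expn_gt0.
  rewrite h3 andbT; apply:
    path_dominates_cst (lt0r_neq0 b0) _ _; first by rewrite gtr0_norm.
  by move=> a /nseqP[->].
split.
  split => //.
    rewrite -[RHS]mulr1 -[X in _ * X](mean_cst 1) -h4''//.
    by congr mean; apply/funext => x; rewrite mul1r.
  rewrite sL wD sd; apply: (@le_trans _ _ (e / 4 + e / 4)); last by lra.
  apply: le_trans (lerD dd h6); apply: le_trans (mean_normD _ _); [|by fin_tac..].
  by apply: mean_norm_le => [||x]; [by fin_tac..|rewrite addrA].
move=> k; rewrite sL take_cat; case: ifPn => kc.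
  split.
    by rewrite map_take dN; apply: le_trans (dk k) _; lra.
  exists (fun=> 0); split; first exact: fin_cst.
    move=> x; rewrite normr0 addr_ge0// mulr_ge0// ?mulr_ge0// ?exprn_ge0//;
    by case: (h4' x) => ->; rewrite ?subr0 ?subrr.
  rewrite (_ : (fun x => _) = wsum (2 ^ s) (take k d)).
    by apply: le_trans (dk k) _; lra.
  by apply/funext => x; rewrite subr0.
split.
  rewrite map_cat dN wD sd; apply: (le_trans (mean_normD _ _)) => //.
  by apply: le_trans (lerD dd (h7 _)) _; lra.
have [u [u1 u2 u3]] := h8 (k - size d)%N; exists u; split => //.
rewrite wD sd; apply: (@le_trans _ _ (e / 4 + (e / 4 + e / 4))); last by lra.
apply: le_trans (lerD dd u3); apply: le_trans (mean_normD _ _); [|by fin_tac..].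
by apply: mean_norm_le => [||x]; [by fin_tac..|rewrite addrA].
Qed.

Definition psum (a : nat -> R) m n x : R := \sum_(m <= j < n) a j * W j x.

Lemma fin_psum a m n : finite_depth (psum a m n).
Proof. by apply: fin_big => j; apply: finM; [exact: fin_cst|exact: fin_W]. Qed.

Lemma psum_wsum (a : nat -> R) c m k :
  (forall j, (j < size c)%N -> c`_j = a (m + j)%N) -> (k <= size c)%N ->
  psum a m (m + k) = wsum m (take k c).
Proof.
move=> h kc; apply/funext => x.
rewrite /psum /wsum size_takel// -{1}[m]addn0 [X in index_iota X]addnC big_addn addKn big_mkord.
apply: eq_bigr => i _; rewrite nth_take// h; last exact: leq_trans (ltn_ord i) kc.
by rewrite addnC.
Qed.

Lemma sum_geo m n : \sum_(m <= j < n) 2 ^- j <= 2 * 2 ^- m :> R.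
Proof.
have [mn|nm] := leqP n m; first by rewrite big_geq// mulr_ge0// invr_ge0 exprn_ge0.
suff : \sum_(m <= j < n) 2 ^- j = 2 * 2 ^- m - 2 * 2 ^- n :> R.
  by move=> ->; rewrite lerBlDr lerDl mulr_ge0// invr_ge0 exprn_ge0.
rewrite (eq_bigr (fun j => (- (2 * 2 ^- j.+1)) - (- (2 * 2 ^- j)))) => [|j _]; last first.
  by rewrite exprS invfM; field; rewrite expf_neq0.
by rewrite telescope_sumr ?(ltnW nm)//; rewrite opprK addrC.
Qed.

Lemma mean_norm_psum_geo (a : nat -> R) m n : (forall j, `|a j| <= 2 ^- j) ->
  mean_norm (psum a m n) <= 2 * 2 ^- m.
Proof.
move=> h; apply: le_trans (sum_geo m n).
rewrite -(mean_cst (\sum_(_ <= _ < _) _)); apply: mean_le.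
- by apply: fin_norm; exact: fin_psum.
- exact: fin_cst.
move=> x; apply: (le_trans (ler_norm_sum _ _ _)); apply: ler_sum => j _.
by rewrite normrM normr_prod big1 ?mulr1// => i _; rewrite rad_norm.
Qed.

Lemma construction (tgt : nat -> fn) (nu : nat -> nat) : (forall n, finite_depth (tgt n)) ->
  exists (a sg : nat -> R) (N : nat -> nat) (A : nat -> fn),
  [/\ forall k, a k.+1 < a k, forall k, sg k = -1 \/ sg k = 1, N 0%N = 1%N &
      forall n, (N n < N n.+1)%N] /\
  [/\ forall n, [/\ finite_depth (A n), forall x, A n x = 0 \/ A n x = 1 &
    mean (A n) = 2 ^- nu n],
      forall n k, (N n <= k <= N n.+1)%N -> mean_norm (psum a (N n) k) <= 3 * 2 ^- n,
      forall n k, (N n <= k <= N n.+1)%N -> exists u, [/\ finite_depth u,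
        dominated (nu n) (tgt n) (A n) u &
         mean_norm (fun x => psum (fun j => sg j * a j) (N n) k x - u x) <= 3 * 2 ^- n] &
      forall n, mean_norm (fun x => psum (fun j => sg j * a j) (N n) (N n.+1) x
         - tgt n x * (1 - 2 ^+ nu n * A n x)) <= 3 * 2 ^- n].
Proof.
move=> ft.
(* Choosing a block for every pair of a stage number and a list makes the recursion below an
   ordinary fixpoint; lists that are not admissible get a dummy value. *)
have /choice[F FP] : forall nL : nat * seq R, exists cA : seq R * fn, admissible nL.2 ->
    [/\ (0 < size cA.1)%N, admissible (nL.2 ++ cA.1) &
      stage_spec (nu nL.1) (tgt nL.1) (2 ^- nL.1) (size nL.2) cA.1 cA.2].
  move=> [n L] /=; have [gL|nL] := pselect (admissible L); last by exists ([::], cst 0).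
  have e0 : 0 < 2 ^- n :> R by rewrite invr_gt0 exprn_gt0.
  by have [c [A h]] := stage_exists (nu n) (ft n) e0 gL; exists (c, A).
(* The initial list is the coefficient of [W 0], before all blocks; its length 2^0 gives N 0 = 1. *)
pose Ls := fix Ls n := if n is n'.+1 then Ls n' ++ (F (n', Ls n')).1 else [:: 1 : R].
pose cs n := (F (n, Ls n)).1; pose A n := (F (n, Ls n)).2; pose N n := size (Ls n).
have LS n : Ls n.+1 = Ls n ++ cs n by [].
have gL n : admissible (Ls n).
  elim: n => [|n IH]; last by have [] := FP (n, Ls n) IH.
  by split; [exists 0%N|rewrite /= /dominates oner_neq0 lexx].
have spec n : stage_spec (nu n) (tgt n) (2 ^- n) (N n) (cs n) (A n).
  by have [] := FP (n, Ls n) (gL n).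
have NS n : (N n < N n.+1)%N.
  by have [h _ _] := FP (n, Ls n) (gL n); rewrite /N LS size_cat -addn1 leq_add2l.
have Nn n : (n < N n)%N.
  by elim: n => [//|n IH]; exact: leq_ltn_trans IH (NS n).
have pre m n : (m <= n)%N -> exists l, Ls n = Ls m ++ l.
  elim: n => [|n IH]; first by rewrite leqn0 => /eqP->; exists [::]; rewrite cats0.
  rewrite leq_eqVlt => /orP[/eqP->|/IH[l e]]; first by exists [::]; rewrite cats0.
  by exists (l ++ cs n); rewrite LS e catA.
(* The lists extend one another and the k-th one has more than k entries, so the diagonal reads off
   the limit sequence. *)
pose cc k := nth 0 (Ls k) k.
have ccE n k : (k < N n)%N -> nth 0 (Ls n) k = cc k.
  move=> kn; rewrite /cc; have [h|h] := leqP n k.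
    by have [l ->] := pre _ _ h; rewrite nth_cat kn.
  by have [l ->] := pre _ _ (ltnW h); rewrite nth_cat Nn.
have cc_nz k : cc k != 0.
  have [_ /(pathP 0)] := gL k; move/(_ k (Nn k)) => /andP[]; by [].
have cc_dec k : `|cc k.+1| <= `|cc k|.
  have [_ /(pathP 0)] := gL k.+1; move/(_ k.+1 (Nn k.+1)) => /andP[_] /=.
  by rewrite -/(cc k.+1) (ccE k.+1 k) // (ltn_trans (ltnSn _) (Nn _)).
(* Adding 2^-k makes the moduli strictly decreasing at a summable cost. *)
pose p j : R := 2 ^- j.
pose sg j := Num.sg (cc j).
have sgcc j : sg j * `|cc j| = cc j by rewrite /sg -numEsg.
have csE n j : (j < size (cs n))%N -> (cs n)`_j = cc (N n + j)%N.
  move=> jc; rewrite -(ccE n.+1); last by rewrite /N LS size_cat ltn_add2l.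
  by rewrite LS nth_cat ltnNge leq_addr addKn.
(* The terms 2^-k with k >= N n sum to at most 2 * 2^-(N n), and n < N n. The perturbation thus
   costs no more than the block itself. *)
have Np n : 2 * 2 ^- N n <= 2 ^- n :> R.
  have := Nn n; case: (N n) => // m; rewrite ltnS => nm.
  rewrite exprS invfM mulrA mulfV ?mul1r ?pnatr_eq0//.
  by rewrite lef_pV2 ?posrE ?exprn_gt0// ler_eXn2l// ltr1n.
have le_k n k : (N n <= k <= N n.+1)%N -> exists2 j, (j <= size (cs n))%N & k = (N n + j)%N.
  move=> /andP[h1 h2]; exists (k - N n)%N; last by rewrite subnKC.
  by rewrite leq_subLR (leq_trans h2)// /N LS size_cat.
have fP b m k : finite_depth (psum b m k : fn) by exact: fin_psum.
have e3 n : 3 * 2 ^- n = 2 ^- n + 2 ^- n + 2 ^- n :> R by ring.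
have pn n : 0 <= 2 ^- n :> R by rewrite invr_ge0 exprn_ge0.
pose a j := `|cc j| + p j.
have aE m k : psum a m k = fun x => psum (fun j => `|cc j|) m k x + psum p m k x.
  by apply/funext => x; rewrite /psum -big_split; apply: eq_bigr => j _; rewrite mulrDl.
have saE m k : psum (fun j => sg j * a j) m k =
    fun x => psum cc m k x + psum (fun j => sg j * p j) m k x.
  apply/funext => x; rewrite /psum -big_split; apply: eq_bigr => j _.
  by rewrite mulrDr sgcc mulrDl.
have np n k : mean_norm (psum p (N n) k) <= 2 ^- n.
  apply: le_trans (Np n); apply: mean_norm_psum_geo => j.
  by rewrite /p ger0_norm.
have nsp n k : mean_norm (psum (fun j => sg j * p j) (N n) k) <= 2 ^- n.
  apply: le_trans (Np n); apply: mean_norm_psum_geo => j.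
  by rewrite normrM /sg normr_sg cc_nz mul1r /p ger0_norm.
exists a, sg, N, A; split; split => //.
- move=> k; by rewrite /a ler_ltD// /p ltf_pV2 ?posrE ?exprn_gt0// ltr_eXn2l// ltr1n.
- move=> k; rewrite /sg; case: (sgrP (cc k)) (cc_nz k); rewrite ?eqxx//; auto.
- by move=> n; have [[]] := spec n.
- move=> n k /le_k[j jc ->]; have [_ /(_ j)[h _]] := spec n.
  rewrite aE; apply: (le_trans (mean_normD _ _)) => //.
  apply: (@le_trans _ _ (2 ^- n + 2 ^- n)); last by rewrite e3 lerDl.
  apply: lerD => //; rewrite (@psum_wsum _ (map Num.norm (cs n))) ?size_map//.
    by rewrite -map_take.
  by move=> i ic; rewrite (nth_map 0) ?csE.
- move=> n k /le_k[j jc ->]; have [_ /(_ j)[_ [u [u1 u2 u3]]]] := spec n.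
  exists u; split => //; rewrite saE.
  apply: (@le_trans _ _ (2 ^- n + 2 ^- n)); last by rewrite e3 lerDl.
  apply: le_trans (lerD u3 (nsp n (N n + j)%N)).
  rewrite -(psum_wsum (csE n) jc).
  apply: le_trans (mean_normD _ _); [|by fin_tac..].
  by apply: mean_norm_le => [||x]; [by fin_tac..|rewrite addrAC].
- move=> n; have [[fA _ _ h] _] := spec n.
  have NE : N n.+1 = (N n + size (cs n))%N by rewrite /N LS size_cat.
  rewrite saE NE; apply: (@le_trans _ _ (2 ^- n + 2 ^- n)); last by rewrite e3 lerDl.
  apply: le_trans (lerD h (nsp n (N n + size (cs n))%N)).
  rewrite (psum_wsum (csE n) (leqnn _)) take_size.
  have fw M l : finite_depth (wsum M l : fn) by exact: fin_wsum.
  have ftn := ft n.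
  apply: le_trans (mean_normD _ _); [|by fin_tac..].
  by apply: mean_norm_le => [||x]; [by fin_tac..|rewrite addrAC].
Qed.

End Construction.

(** * Convergence in norm and the greedy choice *)

(* No exceptional null set is needed: where the series diverges absolutely the
   right-hand side is infinite, and the left-hand side is a real number. *)
Lemma esup_series_tail {R : realType} (u : nat -> R) n :
  ((`|fine (limn_esup (fun m => (\sum_(k < m) u k)%:E)) - \sum_(k < n) u k|)%:E
    <= \sum_(k <oo) (`|u (n + k)%N|)%:E)%E.
Proof.
have [/eqP ->|] := boolP ((\sum_(k <oo) (`|u (n + k)%N|)%:E)%E == +oo%E).
  by rewrite leey.
rewrite -ltey => fin_s.
pose v k := u (n + k)%N.
set t := (\sum_(k <oo) _)%E in fin_s *.
have t0 : (0 <= t)%E by apply: nneseries_ge0 => k _ _; rewrite lee_fin.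
have tf : t = (fine t)%:E by rewrite fineK// ge0_fin_numE.
have bound m : \sum_(k < m) `|v k| <= fine t.
  rewrite -lee_fin -tf -sumEFin -(big_mkord xpredT (fun k => `|v k|%:E)).
  by apply: nneseries_lim_ge => k _ _; rewrite lee_fin.
have cv : cvgn (series v).
  apply: normed_cvg; change (cvgn (series (fun k => `|v k|))).
  apply: nondecreasing_is_cvgn.
    apply/nondecreasing_seqP => m.
    by rewrite seriesS lerDr.
  exists (fine t) => _ [m _ <-]; rewrite /series/= big_mkord; exact: bound.
pose S m := \sum_(k < m) u k.
have SE m : S (m + n)%N = S n + series v m.
  rewrite /S addnC big_split_ord/=; congr (_ + _).
  by rewrite /series/= big_mkord.
have cS : S m @[m --> \oo] --> S n + limn (series v).
  rewrite -(cvg_shiftn n).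
  rewrite (_ : (fun k => _) = fun m => S n + series v m); last by apply/funext =>
    m; exact: SE.
  by apply: cvgD => //; exact: cvg_cst.
have eS : (S m)%:E @[m --> \oo] --> (S n + limn (series v))%:E.
  by apply: cvg_EFin => //; exact: nearW.
rewrite (cvg_limn_einf_sup eS).2/= -/(S n) addrAC subrr add0r tf lee_fin.
rewrite -lim_norm//; apply: limr_le; first exact: is_cvg_norm.
apply: nearW => m; rewrite /series/= big_mkord.
by apply: (le_trans (ler_norm_sum _ _ _)); exact: bound.
Qed.

(** Completeness of L^1 for a series with geometrically decreasing norms. The sum is taken pointwise
    as an upper limit, and the tails are integrated term by term. *)
Lemma L1_series (d : measure_display) (T : measurableType d) (R : realType)
    (mu : {measure set T -> \bar R}) (D : set T) (mD : measurable D)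
    (h : nat -> T -> R) (e : R) :
  (forall n, measurable_fun D (h n)) ->
  (forall n, \int[mu]_(x in D) (`|h n x|)%:E <= (e * 2 ^- n)%:E)%E ->
  exists2 g : T -> R, measurable_fun D g &
    forall n, (\int[mu]_(x in D) (`|g x - \sum_(k < n) h k x|)%:E
      <= (2 * e * 2 ^- n)%:E)%E.
Proof.
move=> mh eh.
have mS n : measurable_fun D (fun x => \sum_(k < n) h k x).
  by apply: measurable_sum.
have mg : measurable_fun D
    (fun x => fine (limn_esup (fun m => (\sum_(k < m) h k x)%:E))).
  apply: (measurableT_comp (f := fine)) => //.
  by apply: measurable_fun_limn_esup => n; apply/measurable_EFinP.
exists (fun x => fine (limn_esup (fun m => (\sum_(k < m) h k x)%:E))) => // n.
have mn k : measurable_fun D (fun x => (`|h k x|)%:E).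
  by apply/measurable_EFinP; exact: measurableT_comp.
apply: (@le_trans _ _ (\int[mu]_(x in D) (\sum_(k <oo) (`|h (n + k)%N x|)%:E))%E).
  apply: ge0_le_integral => //.
  - by apply/measurable_EFinP; apply: measurableT_comp => //; exact: measurable_funB.
  - apply: (@ge0_emeasurable_sum _ _ _ D (fun k x => (`|h (n + k)%N x|)%:E) xpredT) => //.
  - by move=> x _; exact: (@esup_series_tail R (fun k => h k x) n).
rewrite integral_nneseries//.
apply: (@le_trans _ _ (\sum_(k <oo) (e * 2 ^- n * (2^-1) ^+ k)%:E)%E).
  apply: lee_nneseries => k _; first by move=> _; apply: integral_ge0.
  by rewrite (le_trans (eh _))// lee_fin exprD invfM exprVn mulrA.
have e0 : 0 <= e.
  have := eh 0%N; rewrite expr0 invr1 mulr1 -lee_fin; apply: le_trans.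
  by apply: integral_ge0 => x _; rewrite lee_fin.
apply: lime_le; first by apply: is_cvg_nneseries => k _ _;
  rewrite lee_fin !mulr_ge0// ?invr_ge0 ?exprn_ge0// invr_ge0.
apply: nearW => m; rewrite sumEFin lee_fin -mulr_sumr.
have p0 : 0 <= e * 2 ^- n by rewrite mulr_ge0// invr_ge0 exprn_ge0.
rewrite [X in _ <= X](_ : _ = e * 2 ^- n * 2); last by ring.
rewrite ler_wpM2l//.
elim: m => [|m IH]; first by rewrite big_geq.
suff -> : \sum_(0 <= i < m.+1) (2^-1) ^+ i = 2 - (2^-1) ^+ m :> R.
  by rewrite gerBl exprn_ge0// invr_ge0.
elim: m {IH} => [|m IH]; first by rewrite big_nat1 !expr0; lra.
by rewrite big_nat_recr//= IH exprS; field.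
Qed.

Section Greedy.
Context {R : realType} {V : zmodType} (M : V -> R) (cl : V -> Prop).
Hypothesis clB : forall u v, cl u -> cl v -> cl (u - v).
Hypothesis M0 : forall u, 0 <= M u.
Hypothesis MB : forall u v, cl u -> cl v -> M (u - v) <= M u + M v.
Variables (p g t : nat -> V) (C : R) (r0 : V).
Hypotheses (clp : forall n, cl (p n)) (clg : forall n, cl (g n))
  (clt : forall n, cl (t n)) (clr0 : cl r0).
Hypothesis Mp : forall n, M (p n - t n) <= C * 2 ^- n.
Hypothesis Mg : forall n, M (g n) <= C * 2 ^- n.
Hypothesis dense : forall h, cl h -> forall e N, 0 < e ->
  exists2 n, (N <= n)%N & M (h - t n) < e.

Definition accept (r : V) n := M (r - t n) < M r / 2.

(** Block n is spent whatever the decision, because the series may not be rearranged: [p n] is its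
    sum with the signs of the construction, [g n] the one with positive signs. *)
Fixpoint residual n : V := if n is n'.+1
  then residual n' - (if accept (residual n') n' then p n' else g n') else r0.

Lemma cl_residual n : cl (residual n).
Proof. by elim: n => [//|n IH] /=; apply: clB => //; case: ifP. Qed.

Let D n := M (residual n).
(** The last term is the total of all increments C 2^-k, k >= n, that the distance may still suffer;
    with it the distance becomes monotone. *)
Let E n := D n + 2 * (C * 2 ^- n).

Let C0 n : 0 <= C * 2 ^- n. Proof. exact: le_trans (M0 _) (Mg n). Qed.

Let C2 n : C * 2 ^- n.+1 = C * 2 ^- n / 2.
Proof. by rewrite exprS invfM mulrA mulrAC. Qed.

Let D_accept n : accept (residual n) n -> D n.+1 <= D n / 2 + C * 2 ^- n.
Proof.
move=> h; rewrite /D /= h.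
have -> : residual n - p n = (residual n - t n) - (p n - t n) by rewrite opprB addrA subrK.
apply: (le_trans (MB _ _)); [by apply: clB => //; exact: cl_residual|exact: clB|].
by apply: lerD => //; exact: ltW.
Qed.

Let D_reject n : D n.+1 <= D n + C * 2 ^- n.
Proof.
have [h|h] := boolP (accept (residual n) n).
  by apply: (le_trans (D_accept h)); rewrite lerD2r ler_pdivrMr// ler_peMr ?M0// ler1n.
rewrite /D /= (negbTE h); apply: (le_trans (MB _ _)) => //; first exact: cl_residual.
by rewrite lerD2l.
Qed.

Let E_S n : E n.+1 <= E n.
Proof. by have := D_reject n; rewrite /E C2; lra. Qed.

Let E_le m n : (m <= n)%N -> E n <= E m.
Proof.
elim: n => [|n IH]; first by rewrite leqn0 => /eqP->.
rewrite leq_eqVlt => /orP[/eqP->//|]; rewrite ltnS => /IH; exact: le_trans.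
Qed.

Let C_le m n : (m <= n)%N -> C * 2 ^- n <= C * 2 ^- m.
Proof.
elim: n => [|n IH]; first by rewrite leqn0 => /eqP->.
rewrite leq_eqVlt => /orP[/eqP->//|]; rewrite ltnS => /IH; apply: le_trans.
by rewrite C2; have := C0 n; lra.
Qed.

(** Take a target at some n >= N within e/2 of the residual at N. If a stage from N to n accepts,
    the distance is halved there. Otherwise only small terms [g k] are subtracted, the residual
    stays close to the target, and the refusal at n says that it is itself small. *)
Let E_step N e : 0 < e -> exists2 n, (N <= n)%N & E n <= E N / 2 + e + 8 * (C * 2 ^- N).
Proof.
move=> e0; have e20 : 0 < e / 2 by rewrite divr_gt0.
have [n Nn hn] := dense (cl_residual N) N e20.
have E0 k : 0 <= E k by rewrite /E addr_ge0 ?M0// mulr_ge0.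
have [[k [Nk kn ak]]|na] :=
  pselect (exists k, [/\ (N <= k)%N, (k <= n)%N & accept (residual k) k]).
  exists k.+1; first exact: leqW.
  have := D_accept ak; have := E_le Nk; have := C_le Nk; have := C0 N; have := C0 k.
  rewrite /E C2; lra.
exists n => //.
have key k : (N + k <= n)%N ->
    M (residual (N + k) - t n) <= e / 2 + 2 * (C * 2 ^- N) - 2 * (C * 2 ^- (N + k)).
  elim: k => [|k IH] kn; first by rewrite addn0; lra.
  rewrite addnS in kn *; rewrite /= ifN; last first.
    apply/negP => ak; apply: na; exists (N + k)%N; split => //; first exact: leq_addr.
    exact: ltnW.
  rewrite addrAC; apply: (le_trans (MB _ _)) => //.
    by apply: clB => //; exact: cl_residual.
  by have := IH (ltnW kn); have := Mg (N + k); rewrite C2; lra.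
have := key (n - N)%N; rewrite subnKC// leqnn => /(_ isT) h.
have : ~~ accept (residual n) n by apply/negP => an; apply: na; exists n.
rewrite /accept -leNgt => h2; have := E0 N; have := C0 n; have := C0 N; have := C_le Nn.
rewrite /E /D; lra.
Qed.

Lemma greedy_cvg e : 0 < e -> exists N, forall n, (N <= n)%N -> M (residual n) <= e.
Proof.
move=> e0; suff [N EN] : exists N, E N <= e.
  exists N => n Nn; apply: le_trans EN; apply: le_trans (E_le Nn).
  by rewrite /E lerDl mulr_ge0.
have E0 k : 0 <= E k by rewrite /E addr_ge0 ?M0// mulr_ge0.
pose L := inf (range E).
have hi : has_inf (range E).
  by split; [exists (E 0%N), 0%N|exists 0 => _ [n _ <-]].
have LE n : L <= E n by apply: ge_inf; [case: hi|exists n].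
have [L0|L0] := leP L 0.
  have [_ [n _ <-] h] := inf_adherent e0 hi.
  by exists n; rewrite (le_trans (ltW h))// gerDr.
(* If the infimum L were positive, then from E N < 9L/8 the previous step would lead to at most
   9L/16 + L/8 + L/8 < L. *)
have L80 : 0 < L / 8 by rewrite divr_gt0.
have [_ [N1 _ <-] h] := inf_adherent L80 hi.
have [r0' hr] := small_geo (C0 0%N) (e := L / 64) ltac:(by rewrite divr_gt0).
pose N := maxn N1 r0'.
have cN : C * 2 ^- N <= L / 64.
  by have := hr N (leq_maxr _ _); rewrite expr0 invr1 mulr1.
have [n _ hn] := E_step N L80.
have := E_le (leq_maxl N1 r0'); rewrite -/N -/L in h * => hN.
by have := LE n; lra.
Qed.

End Greedy.

(** * The seminorm of a weighted L^1 space *)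

Section Weighted.
Context (d : measure_display) (T : measurableType d) (R : realType)
  (mu : {measure set T -> \bar R}) (D : set T) (w : T -> R).
Hypotheses (mD : measurable D) (mw : measurable_fun D w)
  (w0 : forall x, D x -> 0 <= w x).
Implicit Types f g h : T -> R.

Definition weighted_int f := (\int[mu]_(x in D) (`|f x| * w x)%R%:E)%E.
Definition weighted_finite f := measurable_fun D f /\ (weighted_int f < +oo)%E.
Definition weighted_norm f := fine (weighted_int f).

Lemma measurable_wint f : measurable_fun D f ->
  measurable_fun D (fun x => (`|f x| * w x)%R%:E).
Proof.
move=> mf; apply/measurable_EFinP; apply: measurable_funM => //.
exact: measurableT_comp.
Qed.

Lemma wint_ge0 f : (0 <= weighted_int f)%E.
Proof. by apply: integral_ge0 => x Dx; rewrite lee_fin mulr_ge0// w0. Qed.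

Lemma wnm_ge0 f : 0 <= weighted_norm f. Proof. by rewrite fine_ge0// wint_ge0. Qed.

Lemma wnmK f : weighted_finite f -> ((weighted_norm f)%:E = weighted_int f)%E.
Proof. by case=> _ h; rewrite fineK// ge0_fin_numE// wint_ge0. Qed.

Lemma wnm_bound f (c : R) : measurable_fun D f -> (weighted_int f <= c%:E)%E ->
  weighted_finite f /\ weighted_norm f <= c.
Proof.
move=> mf h; have wf : weighted_finite f by split => //; rewrite (le_lt_trans h)// ltry.
by split => //; rewrite -lee_fin wnmK.
Qed.

Lemma wint_le f g : measurable_fun D f -> measurable_fun D g ->
  {ae mu, forall x, D x -> `|f x| * w x <= `|g x| * w x} -> (weighted_int f <=
    weighted_int g)%E.
Proof.
move=> mf mg h; apply: ae_ge0_le_integral => //; try exact: measurable_wint.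
- by move=> x Dx; rewrite lee_fin mulr_ge0// w0.
- by move=> x Dx; rewrite lee_fin mulr_ge0// w0.
Qed.

Lemma wintD f g : measurable_fun D f -> measurable_fun D g ->
  (weighted_int (fun x => f x + g x)%R <= weighted_int f + weighted_int g)%E.
Proof.
move=> mf mg; rewrite /weighted_int -ge0_integralD//; try exact: measurable_wint;
  try by move=> x Dx; rewrite lee_fin mulr_ge0// w0.
apply: ge0_le_integral => //.
- by move=> x Dx; rewrite lee_fin mulr_ge0// w0.
- by apply: measurable_wint; exact: measurable_funD.
- by apply: emeasurable_funD; exact: measurable_wint.
- by move=> x Dx; rewrite -EFinD lee_fin -mulrDl ler_wpM2r ?w0// ler_normD.
Qed.

Lemma wintN f : weighted_int (fun x => - f x) = weighted_int f.
Proof. by rewrite /weighted_int; under eq_integral do rewrite normrN. Qed.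

Lemma wnmN f : weighted_norm (fun x => - f x) = weighted_norm f.
Proof. by rewrite /weighted_norm wintN. Qed.

Lemma wfinN f : weighted_finite f -> weighted_finite (fun x => - f x).
Proof. by move=> [mf h]; split; [exact: measurableT_comp|rewrite wintN]. Qed.

Lemma wfinD f g : weighted_finite f -> weighted_finite g -> weighted_finite (fun x =>
  f x + g x).
Proof.
move=> [mf hf] [mg hg]; split; first exact: measurable_funD.
by rewrite (le_lt_trans (wintD mf mg))// lte_add_pinfty.
Qed.

Lemma wfinB f g : weighted_finite f -> weighted_finite g -> weighted_finite (fun x =>
  f x - g x).
Proof. by move=> hf hg; apply: wfinD => //; exact: wfinN. Qed.

Lemma wnmD f g : weighted_finite f -> weighted_finite g -> weighted_norm (fun x =>
  f x + g x) <= weighted_norm f + weighted_norm g.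
Proof.
move=> hf hg; rewrite -lee_fin EFinD !wnmK//; last exact: wfinD.
by apply: wintD; [case: hf|case: hg].
Qed.

Lemma wnmB f g : weighted_finite f -> weighted_finite g -> weighted_norm (fun x =>
  f x - g x) <= weighted_norm f + weighted_norm g.
Proof. by move=> hf hg; rewrite -(wnmN g) wnmD//; exact: wfinN. Qed.

Lemma wnm_le f g : measurable_fun D f -> weighted_finite g ->
  {ae mu, forall x, D x -> `|f x| * w x <= `|g x| * w x} ->
  weighted_finite f /\ weighted_norm f <= weighted_norm g.
Proof.
move=> mf hg h; have [mg _] := hg; have := wint_le mf mg h.
by rewrite -(wnmK hg) => /(wnm_bound mf).
Qed.

End Weighted.

(** * Digits and the Lebesgue measure *)

Section LebesgueBits.
Context {R : realType}.
Implicit Types (F G : (nat -> bool) -> R).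

(** With y = 2^(k+1) t, the sine of pi y is (-1)^floor(y) times the sine of pi times the fractional
    part of y, which is positive since y is not an integer. *)
Lemma rademacher_bits (t : R) (k : nat) : 0 <= t ->
  (forall k m : nat, t <> m%:R / 2 ^+ k) -> rademacher k.+1 t = rad k (bits t).
Proof.
move=> t0 h; rewrite /rademacher /rad /bits.
set y := 2 ^+ k.+1 * t.
have y0 : 0 <= y by rewrite mulr_ge0// exprn_ge0.
have /andP[h1 h2] := truncn_itv y0.
have h3 : (Num.truncn y)%:R < y.
  rewrite lt_neqAle h1 andbT; apply/eqP => e; apply: (h k.+1 (Num.truncn y)).
  by rewrite e /y mulrAC mulfV ?mul1r// expf_neq0.
have -> : 2 ^+ k.+1 * pi * t = (y - (Num.truncn y)%:R) * pi + pi *+ Num.truncn y.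
  by rewrite mulrBl mulr_natl subrK /y mulrAC.
have pi0 := pi_gt0 R.
have s0 : 0 < sin ((y - (Num.truncn y)%:R) * pi).
  apply: sin_gt0_pi; rewrite mulr_gt0 ?subr_gt0//= -[ltRHS]mul1r ltr_pM2r//.
  by rewrite ltrBlDr -natr1 addrC in h2 *.
rewrite (alternatingn (@sinDpi R)) sgrM (gtr0_sg s0) mulr1 -signr_odd.
by case: (odd _); rewrite ?expr0 ?expr1 ?sgrN ?sgr1.
Qed.

Lemma leb_set1 (a : R) : leb ([set a] : set (lebesgueR R)) = 0%E.
Proof. exact: (lebesgue_measure_set1 a). Qed.

Lemma ae_nondyadic : {ae (leb : {measure set (lebesgueR R) -> \bar R}),
  forall t, forall k m : nat, t <> m%:R / 2 ^+ k :> R}.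
Proof.
apply: ae_foralln => k; apply: ae_foralln => m.
exists [set (m%:R / 2 ^+ k : R)]; split.
- by rewrite -set_itv1; exact: measurable_itv_leb.
- exact: leb_set1.
- by move=> t /= /contrapT.
Qed.

Lemma ae_leb_filter :
  Filter (almost_everywhere (leb : {measure set (lebesgueR R) -> \bar R})).
Proof. exact: (@ae_filter_ringOfSetsType _ _ _ (leb : {measure set (lebesgueR R) ->
  \bar R})). Qed.

Lemma walsh_ae : {ae (leb : {measure set (lebesgueR R) -> \bar R}), forall t,
  I01 R t -> forall k, walsh k t = W k (bits t)}.
Proof.
apply: (@filterS _ _ ae_leb_filter _ _ _ ae_nondyadic) => t h; rewrite /= in_itv/= =>
  /andP[t0 _] k.
by apply: eq_bigr => i _; exact: rademacher_bits.
Qed.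

Lemma leb_I01 : leb (I01 R) = 1%E.
Proof. by rewrite leb_itv lebesgue_measure_itv/= lte_fin ltr01 sube0. Qed.

Lemma I01E : I01 R = ([set` `[0, 1[ ] : set (lebesgueR R)) `|` [set (1 : R)].
Proof.
apply/seteqP; split => t /=; rewrite !in_itv/=.
  move=> /andP[-> t1]; move: t1; rewrite le_eqVlt => /orP[/eqP->|->]; auto.
by move=> [/andP[-> /ltW->]//|->]; rewrite lexx ler01.
Qed.

Lemma fin_measurable F : finite_depth F ->
  measurable_fun (I01 R) ((fun t => F (bits t)) : lebesgueR R -> R).
Proof.
move=> fF; rewrite I01E; apply/measurable_funU.
- exact: measurable_itv_leb.
- by rewrite -set_itv1; exact: measurable_itv_leb.
split; last exact: measurable_fun_set1.
by have /integrableP[/measurable_EFinP] := fin_integrable fF.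
Qed.

Lemma I01D1 : I01 R `\` [set (1 : R)] = ([set` `[0, 1[ ] : set (lebesgueR R)).
Proof.
apply/seteqP; split => t /=; rewrite !in_itv/=.
  by move=> [/andP[-> t1] /eqP t1']; rewrite lt_neqAle t1' t1.
by move=> /andP[-> t1]; split; [exact: ltW|move=> e; rewrite e ltxx in t1].
Qed.

Lemma integral_fin F : finite_depth F ->
  (\int[leb]_(t in I01 R) (`|F (bits t)|)%:E)%E = (mean_norm F)%:E.
Proof.
move=> fF; have m1 : measurable ([set (1 : R)] : set (lebesgueR R)).
  by rewrite -set_itv1; exact: measurable_itv_leb.
have mI : measurable (I01 R) by exact: measurable_itv_leb.
have mF : measurable_fun (I01 R)
    ((fun t => (`|F (bits t)|)%:E) : lebesgueR R -> \bar R).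
  apply/measurable_EFinP; exact: (fin_measurable (fin_norm fF)).
rewrite (ge0_negligible_integral m1 mI mF _ (leb_set1 1)); last first.
  by move=> t _; rewrite lee_fin.
rewrite I01D1 /mean_norm /mean /Rintegral fineK//.
apply: integrable_fin_num; first exact: measurable_itv_leb.
exact: (fin_integrable (fin_norm fF)).
Qed.

Lemma fin_integrable01 F : finite_depth F ->
  leb.-integrable (I01 R) (EFin \o ((fun t => F (bits t)) : lebesgueR R -> R)).
Proof.
move=> fF; apply/integrableP; split.
  by apply/measurable_EFinP; exact: fin_measurable.
by rewrite (integral_fin fF) ltry.
Qed.

Lemma RintegralD1 (f : lebesgueR R -> R) : L1 f ->
  \int[leb]_(t in I01 R) f t =
  \int[leb]_(t in ([set` `[0, 1[ ] : set (lebesgueR R))) f t.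
Proof.
move=> Lf; have m1 : measurable ([set (1 : R)] : set (lebesgueR R)).
  by rewrite -set_itv1; exact: measurable_itv_leb.
have mI : measurable (I01 R) by exact: measurable_itv_leb.
by rewrite /Rintegral (negligible_integral m1 mI Lf (leb_set1 1)) I01D1.
Qed.

Lemma Rintegral_fin F : finite_depth F -> \int[leb]_(t in I01 R) F (bits t) = mean F.
Proof. by move=> fF; rewrite RintegralD1//; exact: fin_integrable01. Qed.

End LebesgueBits.

(** * Density of the Walsh polynomials *)

Lemma cvge0P {R : realType} (u : nat -> \bar R) : (forall n, 0 <= u n)%E ->
  (u n @[n --> \oo] --> 0%E) <->
  (forall e : R, 0 < e -> exists N, forall n, (N <= n)%N -> (u n <= e%:E)%E).
Proof.
move=> u0; split => [/fine_cvgP[[N1 _ h1] /cvgrPdist_le h2] e e0|h].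
  have [N2 _ {}h2] := h2 _ e0; exists (maxn N1 N2) => n.
  rewrite geq_max => /andP[n1 n2].
  have := h2 n n2; have := h1 n n1 => /= f; rewrite sub0r normrN ger0_norm ?fine_ge0//.
  by rewrite -lee_fin fineK.
apply/fine_cvgP; split.
  have [N hN] := h 1 ltr01; exists N => // n /= /hN un.
  by rewrite ge0_fin_numE// (le_lt_trans un)// ltry.
apply/cvgrPdist_le => e e0; have [N hN] := h e e0; exists N => // n /= /hN un.
rewrite sub0r normrN ger0_norm ?fine_ge0// -lee_fin fineK//.
by rewrite ge0_fin_numE// (le_lt_trans un)// ltry.
Qed.

Section Approximable.
Import HBSimple.
Context (d : measure_display) (T : measurableType d) (R : realType)
  (mu : {measure set T -> \bar R}) (D : set T) (K : (T -> R) -> Prop).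
Hypotheses (mD : measurable D) (Kmeas : forall f, K f -> measurable_fun D f)
  (K0 : K (fun=> 0))
  (KD : forall f g, K f -> K g -> K (fun x => f x + g x))
  (KZ : forall (a : R) f, K f -> K (fun x => a * f x))
  (Kmax : forall f g, K f -> K g -> K (fun x => Num.max (f x) (g x))).
Implicit Types f g h : T -> R.

Definition l1 f := weighted_int mu D (fun=> 1) f.

(** Membership in the L^1 closure of [K], which will consist of the functions of finitely many
    digits. *)
Definition approximable f := measurable_fun D f /\
  forall e : R, 0 < e -> exists2 F, K F & (l1 (fun x => f x - F x)%R <= e%:E)%E.

Let w1 : measurable_fun D (fun=> 1 : R). Proof. exact: measurable_cst. Qed.
Let w0 x : D x -> 0 <= (1 : R). Proof. by move=> _; exact: ler01. Qed.

Lemma l1_triangle f g h : measurable_fun D f -> measurable_fun D g ->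
  measurable_fun D h ->
  (l1 (fun x => f x - h x)%R <= l1 (fun x => f x - g x)%R + l1 (fun x => g x - h x)%R)%E.
Proof.
move=> mf mg mh; rewrite /l1.
have -> : (fun x => f x - h x) = (fun x => (f x - g x) + (g x - h x)).
  by apply/funext => x; rewrite addrA subrK.
by apply: wintD => //; exact: measurable_funB.
Qed.

Lemma l1_le f g : measurable_fun D f -> measurable_fun D g ->
  (forall x, D x -> `|f x| <= `|g x|) -> (l1 f <= l1 g)%E.
Proof.
move=> mf mg h; apply: wint_le => //; apply: aeW => x Dx; rewrite !mulr1; exact: h.
Qed.

Lemma l1_indic f A : measurable_fun D f -> measurable A ->
  (forall x, D x -> `|f x| <= \1_A x) -> (l1 f <= mu A)%E.
Proof.
move=> mf mA h; apply: (@le_trans _ _ (mu (A `&` D))); last first.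
  by apply: le_measure; rewrite ?inE//; exact: measurableI.
rewrite -integral_indic//; apply: ge0_le_integral => //.
- exact: measurable_wint.
- by apply/measurable_EFinP; exact: measurable_indic.
- by move=> x Dx; rewrite lee_fin mulr1 h.
Qed.

Lemma approximable_lim f : measurable_fun D f ->
  (forall e : R, 0 < e -> exists2 g, approximable g & (l1 (fun x => f x - g x)%R <=
    e%:E)%E) ->
  approximable f.
Proof.
move=> mf h; split => // e e0; have e20 : 0 < e / 2 by rewrite divr_gt0.
have [g [mg ag] fg] := h _ e20; have [F KF gF] := ag _ e20.
exists F => //; apply: (le_trans (l1_triangle mf mg (Kmeas KF))).
by rewrite [e]splitr EFinD leeD.
Qed.

Lemma approximable_sub f : K f -> approximable f.
Proof.
move=> Kf; split; first exact: Kmeas.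
move=> e e0; exists f => //; rewrite /l1 /weighted_int.
under eq_integral do rewrite subrr normr0 mul0r.
by rewrite integral0 lee_fin ltW.
Qed.

(** One argument for sums and for maxima, the latter giving finite unions of sets: both operations
    are 1-Lipschitz for the l^1 distance on pairs. *)
Lemma approximable_op (op : R -> R -> R) f g :
  (forall a b a' b', `|op a b - op a' b'| <= `|a - a'| + `|b - b'|) ->
  (forall u v, K u -> K v -> K (fun x => op (u x) (v x))) ->
  (forall u v, measurable_fun D u -> measurable_fun D v ->
    measurable_fun D (fun x => op (u x) (v x))) ->
  approximable f -> approximable g -> approximable (fun x => op (f x) (g x)).
Proof.
move=> lip Kop mop [mf af] [mg ag]; split; first exact: mop.
move=> e e0; have e20 : 0 < e / 2 by rewrite divr_gt0.
have [F KF fF] := af _ e20; have [G KG gG] := ag _ e20.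
have mF := Kmeas KF; have mG := Kmeas KG.
exists (fun x => op (F x) (G x)); first exact: Kop.
have mfF : measurable_fun D (fun x => `|f x - F x|).
  by apply: measurableT_comp => //; exact: measurable_funB.
have mgG : measurable_fun D (fun x => `|g x - G x|).
  by apply: measurableT_comp => //; exact: measurable_funB.
apply: (@le_trans _ _ (l1 (fun x => `|f x - F x| + `|g x - G x|)%R)).
  apply: l1_le; [|exact: measurable_funD|].
    by apply: measurable_funB; exact: mop.
  by move=> x _; rewrite [leRHS]ger0_norm ?addr_ge0//; exact: lip.
apply: (le_trans (wintD mu mD w1 w0 mfF mgG)).
rewrite [e]splitr EFinD leeD//.
  apply: le_trans fF; apply: l1_le => //; first exact: measurable_funB.
  by move=> x _; rewrite normr_id.
apply: le_trans gG; apply: l1_le => //; first exact: measurable_funB.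
by move=> x _; rewrite normr_id.
Qed.

Lemma approximableD f g : approximable f -> approximable g ->
  approximable (fun x => f x + g x).
Proof.
apply: (approximable_op (op := fun a b => a + b)) => [a b a' b'||].
- by rewrite opprD addrACA; exact: ler_normD.
- exact: KD.
- by move=> u v; exact: measurable_funD.
Qed.

Lemma approximable_max f g : approximable f -> approximable g ->
  approximable (fun x => Num.max (f x) (g x)).
Proof.
apply: (approximable_op (op := Num.max)) => [a b a' b'||].
- rewrite ler_norml; apply/andP; split.
    rewrite lerNl opprB lerBlDr ge_max; apply/andP; split.
      have : a <= Num.max a b by rewrite le_max lexx.
      have := ler_norm (a' - a); rewrite distrC; have := normr_ge0 (b - b'); lra.
    have : b <= Num.max a b by rewrite le_max lexx orbT.
    have := ler_norm (b' - b); rewrite distrC; have := normr_ge0 (a - a'); lra.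
  rewrite lerBlDr ge_max; apply/andP; split.
    have : a' <= Num.max a' b' by rewrite le_max lexx.
    have := ler_norm (a - a'); have := normr_ge0 (b - b'); lra.
  have : b' <= Num.max a' b' by rewrite le_max lexx orbT.
  have := ler_norm (b - b'); have := normr_ge0 (a - a'); lra.
- exact: Kmax.
- by move=> u v mu1 mv; exact: measurable_maxr.
Qed.

Lemma approximableZ (a : R) f : approximable f -> approximable (fun x => a * f x).
Proof.
move=> [mf af]; split; first exact: measurable_funM.
move=> e e0; have a1 : 0 < `|a| + 1 by rewrite ltr_wpDl.
have [F KF fF] := af (e / (`|a| + 1)) (divr_gt0 e0 a1).
exists (fun x => a * F x); first exact: KZ.
have mfF : measurable_fun D (fun x => f x - F x) by apply: measurable_funB =>
  //; exact: Kmeas.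
apply: (@le_trans _ _ ((`|a| + 1)%:E * l1 (fun x => f x - F x)%R)%E).
  rewrite /l1 /weighted_int -ge0_integralZl//; last exact: measurable_wint.
  apply: ge0_le_integral => //.
  - by apply: measurable_wint => //; apply: measurable_funB;
      apply: measurable_funM => //; exact: Kmeas.
  - by apply: measurable_funeM; exact: measurable_wint.
  - move=> x _; rewrite -EFinM lee_fin !mulr1 -mulrBr normrM ler_wpM2r//.
    by rewrite lerDl.
apply: (@le_trans _ _ ((`|a| + 1)%:E * (e / (`|a| + 1))%:E)%E).
  by apply: lee_wpmul2l => //; rewrite lee_fin ltW.
by rewrite -EFinM lee_fin mulrC divfK// lt0r_neq0.
Qed.

Hypothesis aind : forall A, measurable A -> approximable \1_A.

Lemma approximable_sfun (f : {sfun T >-> R}) : approximable (fun x => f x).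
Proof.
have -> : (fun x => f x) = fun x => \sum_(y <- finmap.enum_fset (fset_set (range f)))
    (y * \1_(f @^-1` [set y]) x).
  by apply/funext => x; rewrite fimfunE fsbig_finite.
have az : approximable (fun=> 0) by exact: approximable_sub.
elim: (finmap.enum_fset _) => [|i r IH].
  by under [fun _ => _]eq_fun do rewrite big_nil.
under [fun _ => _]eq_fun do rewrite big_cons.
apply: approximableD => //; apply: approximableZ; exact: aind.
Qed.

Lemma approximable_integrable f : mu.-integrable D (EFin \o f) -> approximable f.
Proof.
move=> intf; have /integrableP[/measurable_EFinP mf _] := intf.
apply: approximable_lim => // e e0.
have [g [_ _ cg]] := approximation_sfun_integrable mD intf.
have g0 n : (0 <= \int[mu]_(z in D) `|(EFin \o f) z - (g n z)%:E|)%E.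
  exact: integral_ge0.
have [N hN] := (cvge0P g0).1 cg _ e0.
exists (fun x => g N x); first exact: approximable_sfun.
apply: le_trans (hN N (leqnn N)); rewrite /l1 /weighted_int.
by under eq_integral do rewrite mulr1.
Qed.

(** Only f w has to be integrable, not f. The truncations of f at height n are bounded and converge
    to f in the weighted norm by dominated convergence; for a bounded function, approximation in L^1
    suffices because w <= 1. *)
Lemma approximable_weighted (w : T -> R) f (e : R) : (mu D < +oo)%E ->
  measurable_fun D w -> (forall x, D x -> 0 <= w x <= 1) ->
  weighted_finite mu D w f -> 0 < e ->
  exists2 F, K F & (weighted_int mu D w (fun x => f x - F x)%R <= e%:E)%E.
Proof.
move=> muD mw w01 [mf wf] e0.
have ww x : D x -> 0 <= w x by move=> /w01/andP[].
pose t n x := if `|f x| <= n%:R then f x else 0.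
have mt n : measurable_fun D (t n).
  apply: measurable_fun_if => //.
    by apply: measurable_fun_ler => //; exact: measurableT_comp.
  by apply: measurable_funS mf => //; exact: subIsetl.
pose u n x := (`|f x - t n x| * w x)%:E.
have mu_ n : measurable_fun D (u n).
  by apply: measurable_wint => //; exact: measurable_funB.
have [_ _ cu] : [/\ mu.-integrable D (cst 0%E : T -> \bar R),
  [sequence (\int[mu]_(x in D) `|u n x - cst 0 x|)%E]_n @ \oo --> 0%E &
  [sequence (\int[mu]_(x in D) u n x)%E]_n @ \oo --> (\int[mu]_(x in D) (cst 0 x))%E].
  apply: (@dominated_convergence _ _ _ mu D mD u (cst 0%E) (fun x =>
    (`|f x| * w x)%:E)) => //.
  - apply: aeW => x Dx; apply: cvg_near_cst.
    exists (Num.truncn `|f x|).+1 => // n /= hn.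
    rewrite /u /t ifT ?subrr ?normr0 ?mul0r//.
    by rewrite (le_trans (ltW (truncnS_gt _)))// ler_nat.
  - apply/integrableP; split; first exact: measurable_wint.
    rewrite (_ : (\int[mu]_(x in D) _)%E = weighted_int mu D w f)//.
    by apply: eq_integral => x /set_mem Dx; rewrite gee0_abs// lee_fin mulr_ge0// ww.
  - apply: aeW => x n Dx; rewrite gee0_abs; last by rewrite lee_fin mulr_ge0// ww.
    rewrite lee_fin ler_wpM2r ?ww// /t; case: ifPn => _; first by rewrite subrr normr0.
    by rewrite subr0.
rewrite integral0 in cu.
have u0 n : (0 <= \int[mu]_(x in D) u n x)%E.
  by apply: integral_ge0 => x Dx; rewrite lee_fin mulr_ge0// ww.
have e20 : 0 < e / 2 by rewrite divr_gt0.
have [N hN] := (cvge0P u0).1 cu _ e20.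
have it : mu.-integrable D (EFin \o t N).
  apply/integrableP; split; first exact/measurable_EFinP.
  apply: (@le_lt_trans _ _ (\int[mu]_(x in D) (N%:R%:E))%E).
    apply: ge0_le_integral => //.
    + by apply: measurableT_comp => //; exact/measurable_EFinP.
    + by move=> x _; rewrite lee_fin /t; case: ifP => //; rewrite normr0.
  by rewrite integral_cst//= lte_mul_pinfty// lee_fin.
have [_ /(_ _ e20)[F KF tF]] := approximable_integrable it.
exists F => //; have mF := Kmeas KF.
have -> : (fun x => f x - F x) = (fun x => (f x - t N x) + (t N x - F x)).
  by apply/funext => x; rewrite addrA subrK.
apply: (le_trans (wintD mu mD mw ww _ _)); [exact: measurable_funB..|].
rewrite [e]splitr EFinD leeD//; first exact: hN.
apply: le_trans tF; apply: ge0_le_integral => //.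
- by move=> x Dx; rewrite lee_fin mulr_ge0// ww.
- by apply: measurable_wint => //; exact: measurable_funB.
- by apply: measurable_wint => //; exact: measurable_funB.
- by move=> x Dx; rewrite lee_fin ler_wpM2l//; have /andP[] := w01 x Dx.
Qed.

End Approximable.

(** * Approximation of indicator functions of measurable sets *)

Section Indicators.
Context {R : realType}.
Notation leb := (leb : {measure set (lebesgueR R) -> \bar R}).
Notation I01 := (I01 R).

Definition on_bits (h : lebesgueR R -> R) := exists2 F, finite_depth F & forall t,
  h t = F (bits t).

Lemma on_bits_measurable h : on_bits h -> measurable_fun I01 h.
Proof.
move=> [F fF hF]; rewrite (_ : h = fun t => F (bits t)); last exact/funext.
exact: fin_measurable.
Qed.

Lemma on_bits_cst (c : R) : on_bits (fun=> c).
Proof. by exists (fun=> c) => //; exact: fin_cst. Qed.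

Lemma on_bits_op (op : R -> R -> R) h h' : on_bits h -> on_bits h' ->
  on_bits (fun t => op (h t) (h' t)).
Proof.
move=> [F fF hF] [G fG hG]; exists (fun x => op (F x) (G x)); first exact: fin2.
by move=> t; rewrite hF hG.
Qed.

Lemma on_bitsD h h' : on_bits h -> on_bits h' -> on_bits (fun t => h t + h' t).
Proof. exact: (on_bits_op (fun a b => a + b)). Qed.

Lemma on_bits_max h h' : on_bits h -> on_bits h' -> on_bits (fun t => Num.max (h t) (h' t)).
Proof. exact: (on_bits_op (fun a b => Num.max a b)). Qed.

Lemma on_bitsZ (a : R) h : on_bits h -> on_bits (fun t => a * h t).
Proof. by move=> hh; exact: (on_bits_op (fun b _ => a * b) hh (on_bits_cst 0)). Qed.

(** The digits put together again: on [0, 1) this is t rounded down to a multiple of 2^-n. *)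
Definition dyad n (x : nat -> bool) : R := \sum_(k < n) (x k)%:R / 2 ^+ k.+1.

Lemma dep_dyad n : depends_on n (dyad n).
Proof. by move=> x y e; apply: eq_bigr => k _; rewrite e. Qed.

Lemma dyad_bits n (t : R) : 0 <= t < 1 ->
  dyad n (bits t) = (Num.truncn (2 ^+ n * t))%:R / 2 ^+ n.
Proof.
move=> /andP[t0 t1]; elim: n => [|n IH].
  rewrite /dyad big_ord0 expr0 mul1r (_ : Num.truncn t = 0%N) ?mul0r//.
  by apply/eqP; rewrite truncn_eq// t0.
rewrite /dyad big_ord_recr/= -/(dyad n _) IH /bits.
set m := Num.truncn (2 ^+ n.+1 * t).
have y0 : 0 <= 2 ^+ n.+1 * t by rewrite mulr_ge0// exprn_ge0.
have := truncn_itv y0; rewrite -/m => hm.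
have -> : Num.truncn (2 ^+ n * t) = m./2.
  case: n @m y0 hm {IH} => [|n] m y0 hm.
    rewrite expr0 mul1r (_ : Num.truncn t = 0%N); last by apply/eqP; rewrite truncn_eq// t0.
    have : (m < 2)%N.
      have /andP[h _] := hm; rewrite -(ltr_nat R); apply: le_lt_trans h _.
      by rewrite expr1 -[ltRHS]mulr1 ltr_pM2l.
    by case: m {hm} => [|[|]].
  by rewrite (@truncn_dyadic _ n.+2 m n)// subSnn expn1 divn2.
rewrite -{3}(odd_double_half m) natrD -mul2n natrM exprS; field.
by rewrite expf_neq0.
Qed.

Lemma dyad_near n (t : R) : 0 <= t < 1 -> dyad n (bits t) <= t < dyad n (bits t) + 2 ^- n.
Proof.
move=> t01; rewrite dyad_bits//; have /andP[t0 t1] := t01.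
have /truncn_itv/andP[g1 g2] : 0 <= 2 ^+ n * t by rewrite mulr_ge0// exprn_ge0.
have p2 : 0 < 2 ^+ n :> R by rewrite exprn_gt0.
rewrite ler_pdivrMr// -[X in _ + X]mul1r -mulrDl natr1 ltr_pdivlMr// [t * _]mulrC.
by apply/andP; split; [exact: g1|exact: g2].
Qed.

(** If t is replaced by its first n0 digits, the comparison with c can change only on
    [c, c + 2^-n0], or at t = 1, where the digits do not represent t. *)
Lemma approximable_le (c : R) : approximable leb I01 on_bits (fun t => (t <= c)%R%:R).
Proof.
have mle : measurable_fun I01 ((fun t => (t <= c)%R%:R) : lebesgueR R -> R).
  rewrite (_ : (fun t => _) = \1_([set` `]-oo, c] ] : set (lebesgueR R))).
    by apply: measurable_indic; exact: measurable_itv_leb.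
  by apply/funext => t; rewrite indicE mem_setE in_itv.
split => // e e0.
have [n0 hn0] := small_geo (ler01 : 0 <= 1 :> R) e0.
have := hn0 n0 (leqnn n0); rewrite mul1r => hn.
exists (fun t => (dyad n0 (bits t) <= c)%R%:R).
  exists (fun x => (dyad n0 x <= c)%R%:R) => //.
  by exists n0 => x y xy; rewrite (dep_dyad xy).
pose B : set (lebesgueR R) := [set` `[c, c + 2 ^- n0] ] `|` [set (1 : R)].
have m1 : measurable ([set (1 : R)] : set (lebesgueR R)).
  by rewrite -set_itv1; exact: measurable_itv_leb.
have mB : measurable B by apply: measurableU => //; exact: measurable_itv_leb.
apply: (@le_trans _ _ (leb B)).
  apply: l1_indic; [exact: measurable_itv_leb| |exact: mB|].
    apply: measurable_funB; first exact: mle.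
    apply: on_bits_measurable.
    exists (fun x => (dyad n0 x <= c)%R%:R) => //.
    by exists n0 => x y xy; rewrite (dep_dyad xy).
  move=> t /=; rewrite in_itv/= => /andP[t0 t1]; rewrite indicE.
  have [tB|tB] := boolP (t \in B).
    by case: (t <= c); case: (_ <= c); rewrite ?subrr ?subr0 ?sub0r ?normrN ?normr0 ?normr1.
  have t1' : t < 1.
    rewrite lt_neqAle t1 andbT; apply: contra tB => /eqP ->.
    by rewrite inE; right.
  have t01 : 0 <= t < 1 by rewrite t0.
  have /andP[h1 h2] := dyad_near n0 t01.
  have [tc|ct] := leP t c; first by rewrite (le_trans h1 tc) subrr normr0.
  have [vc|cv] := leP (dyad n0 (bits t)) c; last by rewrite subrr normr0.
  exfalso; move/negP: tB; apply; rewrite inE; left; rewrite /= in_itv/= (ltW ct)/=.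
  by rewrite (le_trans (ltW h2))// lerD2r.
have e1 : (leb ([set (1%R : R)] : set (lebesgueR R)) <= 0)%E.
  by rewrite le_eqVlt; apply/orP; left; apply/eqP; exact: leb_set1.
have e2 : (leb ([set` `[c, (c + 2 ^- n0)%R] ] : set (lebesgueR R)) <= e%:E)%E.
  apply: (@le_trans _ _ (lebesgue_measure [set` `[c, c + 2 ^- n0] ])) => //.
  rewrite lebesgue_measure_itv/= lte_fin.
  by case: ifP => _; rewrite ?lee_fin ?(ltW e0)// addrAC subrr add0r.
have h3 := leeD e2 e1; rewrite adde0 in h3.
exact: (le_trans (measureU2 leb (measurable_itv_leb `[c, c + 2 ^- n0]) m1) h3).
Qed.

Lemma approximable_itv (a b : R) :
  approximable leb I01 on_bits \1_([set` `]a, b] ] : set (lebesgueR R)).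
Proof.
have mI : measurable I01 by exact: measurable_itv_leb.
have [ab|ba] := leP a b; last first.
  have -> : [set` `]a, b] ] = set0 :> set (lebesgueR R).
    by apply/seteqP; split => t //=; rewrite in_itv/= => /andP[/lt_le_trans h /h];
      rewrite ltNge (ltW ba).
  rewrite indic0; apply: approximable_sub; first exact: on_bits_measurable.
  exact: on_bits_cst.
rewrite (_ : \1_ _ = fun t => (t <= b)%R%:R + -1 * (t <= a)%R%:R); last first.
  apply/funext => t; rewrite indicE mem_setE in_itv/=.
  have [ta|at_] := leP t a; first by rewrite (le_trans ta ab)/= mulr1 subrr.
  by case: (t <= b); rewrite ?mulr0 ?addr0.
apply: (approximableD mI on_bits_measurable on_bitsD); first exact: approximable_le.
apply: (approximableZ mI on_bits_measurable on_bitsZ); exact: approximable_le.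
Qed.

Lemma approximable_bigcup_itv (A : nat -> set (lebesgueR R)) n :
  (forall k, exists a b : R, A k = [set` `]a, b] ]) ->
  approximable leb I01 on_bits \1_(\big[setU/set0]_(k < n) A k).
Proof.
move=> hA; have mI : measurable I01 by exact: measurable_itv_leb.
elim: n => [|n IH].
  rewrite big_ord0 indic0; apply: approximable_sub; first exact: on_bits_measurable.
  exact: on_bits_cst.
rewrite big_ord_recr/=.
rewrite (_ : \1_ _ = fun t =>
  Num.max (\1_(\big[setU/set0]_(k < n) A k) t) (\1_(A n) t) : R).
  apply: (approximable_max mI on_bits_measurable on_bits_max) => //.
  by have [a [b ->]] := hA n; exact: approximable_itv.
apply/funext => t; rewrite !indicE in_setU.
by case: (_ \in _); case: (_ \in _); rewrite /= ?maxxx ?(max_l ler01) ?(max_r ler01).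
Qed.

(** Lebesgue outer measure is an infimum over countable coverings by half-open intervals. Keep
    finitely many intervals of a nearly optimal covering: the error lies in the excess of the
    covering over the set and in the discarded tail, each of measure at most e/2. *)
Lemma approximable_indic (B : set (lebesgueR R)) : measurable B ->
  approximable leb I01 on_bits \1_B.
Proof.
move=> mB0; have mI : measurable I01 by exact: measurable_itv_leb.
pose B' := B `&` I01.
have mB' : measurable B' by exact: measurableI.
have lebI : (leb I01 <= 1)%E.
  by rewrite le_eqVlt; apply/orP; left; apply/eqP; exact: leb_I01.
have lebB' : (leb B' <= 1)%E.
  by apply: le_trans lebI; apply: le_measure; rewrite ?inE//; exact: subIsetr.
have fB' : leb B' \is a fin_num.
  by rewrite ge0_fin_numE ?measure_ge0// (le_lt_trans lebB')// ltry.
apply: approximable_lim; [exact: mI|exact: on_bits_measurable| |].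
  exact: measurable_indic.
move=> e e0; have e20 : 0 < e / 2 by rewrite divr_gt0.
have [_ [A [mA cA] <-] hA] := lb_ereal_inf_adherent e20 fB'.
have mAk k : measurable (A k : set (lebesgueR R)).
  by apply: sub_caratheodory; apply: sub_sigma_algebra; exact: mA.
have AE k : leb (A k) = wlength idfun (A k).
  exact: (measurable_mu_extE _ (mA k)).
have w0 k : (0 <= wlength idfun (A k : set (ocitv_type R)))%E by rewrite -AE measure_ge0.
set s := (\sum_(k <oo) wlength idfun (A k))%E in hA.
have s_fin : (s < +oo)%E.
  apply: (lt_trans hA); rewrite lte_add_pinfty ?ltry//.
  by rewrite (le_lt_trans lebB')// ltry.
have : (\sum_(N <= k <oo) wlength idfun (A k))%E @[N --> \oo] --> 0%E.
  exact: nneseries_tail_cvg.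
have t0 N : (0 <= \sum_(N <= k <oo) wlength idfun (A k))%E.
  by apply: nneseries_ge0 => k _ _.
move=> /(cvge0P t0) /(_ _ e20)[N hN]; have {hN} := hN N (leqnn N) => hN.
exists (\1_(\big[setU/set0]_(k < N) A k)).
  apply: approximable_bigcup_itv => k.
  by have [[a b] _ <-] := mA k; exists a, b.
pose U : set (lebesgueR R) := \bigcup_k A k.
pose V : set (lebesgueR R) := \bigcup_(k in ~` `I_N) A k.
have mU : measurable U by exact: bigcupT_measurable.
have mV : measurable V by exact: bigcup_measurable.
have mUB : measurable (U `\` B') by exact: measurableD.
have mUN : measurable (\big[setU/set0]_(k < N) (A k : set (lebesgueR R))).
  by apply: bigsetU_measurable => k _; exact: mAk.
have lebV : (leb V <= (e / 2)%:E)%E.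
  apply: le_trans hN; rewrite -(eq_eseriesr (fun k _ => AE k)).
  exact: (outer_measure_sigma_subadditive_tail (mu_ext (@wlength R idfun)) N A).
have lebU : (leb U <= leb B' + (e / 2)%:E)%E.
  apply: le_trans (ltW hA); rewrite /s -(eq_eseriesr (fun k _ => AE k)).
  exact: (outer_measure_sigma_subadditive (mu_ext (@wlength R idfun)) A).
have lebUB : (leb (U `\` B') <= (e / 2)%:E)%E.
  rewrite measureD//; last first.
    by apply: (le_lt_trans lebU); rewrite -(fineK fB') -EFinD ltry.
  by rewrite setIidr// leeBlDl.
apply: (@le_trans _ _ (leb ((U `\` B') `|` V))); last first.
  apply: (le_trans (measureU2 leb mUB mV)).
  by rewrite [e]splitr EFinD leeD.
apply: l1_indic; [exact: mI| |exact: measurableU|].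
  by apply: measurable_funB; exact: measurable_indic.
move=> t It; rewrite !indicE.
have [tUV|tUV] := boolP (t \in _ `|` V).
  by case: (_ \in _); case: (_ \in _); rewrite ?subrr ?subr0 ?sub0r ?normrN ?normr0 ?normr1.
have nUV : ~ ((U `\` B') `|` V) t by move=> h; move/negP: tUV; apply; rewrite inE.
have -> : (t \in B) = (t \in \big[setU/set0]_(k < N) A k); last by rewrite subrr normr0.
rewrite -bigcup_mkord; apply/idP/idP => /set_mem Bt; apply/mem_set.
  have [k _ Akt] := cA t (conj Bt It).
  have [kN|Nk] := ltnP k N; first by exists k.
  by exfalso; apply: nUV; right; exists k => //=; rewrite ltnNge Nk.
move: Bt => [k /= kN Akt]; apply: contrapT => nB; apply: nUV; left; split.
  by exists k.
by move=> [].
Qed.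

End Indicators.

(** * Walsh polynomials with rational coefficients *)

Section Density.
Context {R : realType}.
Notation leb := (leb : {measure set (lebesgueR R) -> \bar R}).
Notation I01 := (I01 R).
Notation fn := ((nat -> bool) -> R).

(** F is split into its even and odd parts in the last digit; multiplying the odd part by [rad n]
    shifts its indices by 2^n. *)
Lemma walsh_expansion n (F : fn) : depends_on n F ->
  exists2 c : seq R, size c = (2 ^ n)%N & forall x, F x = wsum 0 c x.
Proof.
elim: n F => [|n IH] F dF.
  exists [:: F xpred0] => // x; rewrite /wsum /= big_ord1/= W0 mulr1.
  exact: dF.
pose S b : fn := fun x => F (set_digit x n b).
have dS b : depends_on n (S b).
  move=> x y xy; apply: dF => k; rewrite ltnS leq_eqVlt /set_digit => /orP[->//|kn].
  by rewrite ltn_eqF// xy.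
have [c0 s0 h0] := IH (fun x => (S false x + S true x) / 2)
  (dep2 (fun a b => (a + b) / 2) (dS _) (dS _)).
have [c1 s1 h1] := IH (fun x => (S false x - S true x) / 2)
  (dep2 (fun a b => (a - b) / 2) (dS _) (dS _)).
exists (c0 ++ c1); first by rewrite size_cat s0 s1 expnS mul2n addnn.
move=> x; rewrite wsum_cat add0n s0.
have -> : wsum (2 ^ n) c1 x = rad n x * wsum 0 c1 x.
  rewrite /wsum mulr_sumr; apply: eq_bigr => i _.
  have ii : (i < 2 ^ n)%N by rewrite -s1.
  by rewrite (W_add x ii) add0n mulrCA.
rewrite -h0 -h1; have -> : F x = S (x n) x.
  by apply: dF => k _; rewrite /set_digit; case: eqP => // ->.
by rewrite /rad; case: (x n); rewrite ?expr0 ?expr1; field.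
Qed.

Definition wpoly (l : seq rat) : fn := wsum 0 (map ratr l).

Lemma fin_wpoly l : finite_depth (wpoly l). Proof. exact: fin_wsum. Qed.

Lemma rat_approx (r e : R) : 0 < e -> exists q : rat, `|r - ratr q| <= e.
Proof.
move=> e0; have re : r - e < r + e by lra.
have [q] := rat_in_itvoo re.
by rewrite in_itv/= => /andP[h1 h2]; exists q; rewrite ler_norml; apply/andP; split; lra.
Qed.

Lemma mean_norm_W k : mean_norm (W k : fn) = 1.
Proof.
rewrite -[RHS](mean_cst 1); congr mean; apply/funext => x.
by rewrite normr_prod big1// => i _; rewrite rad_norm.
Qed.

Lemma wpoly_dense (F : fn) (e : R) : finite_depth F -> 0 < e ->
  exists l, mean_norm (fun x => F x - wpoly l x) <= e.
Proof.
move=> [n dF] e0; have [c sc hc] := walsh_expansion dF.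
have e1 : 0 < e / 2 ^+ n by rewrite divr_gt0// exprn_gt0.
have /choice[q hq] : forall r : R, exists q : rat, `|r - ratr q| <= e / 2 ^+ n.
  by move=> r; exact: rat_approx.
exists (map q c).
have -> : (fun x => F x - wpoly (map q c) x) =
    fun x => \sum_(i < size c) (c`_i - ratr (q c`_i)) * W (0 + i) x.
  apply/funext => x; rewrite hc /wpoly /wsum !size_map -sumrB.
  apply: eq_bigr => i _; rewrite mulrBl (nth_map 0) ?size_map// (nth_map 0)//.
have fW i : finite_depth (fun x => (c`_i - ratr (q c`_i)) * W (0 + i) x).
  by apply: finM; [exact: fin_cst|exact: fin_W].
apply: (@le_trans _ _ (mean (fun x =>
  \sum_(i < size c) `|(c`_i - ratr (q c`_i)) * W (0 + i) x|))).
  apply: mean_le => [||x]; last exact: ler_norm_sum.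
    by apply: fin_norm; apply: fin_big => i; exact: fW.
  by apply: fin_big => i; apply: fin_norm; exact: fW.
rewrite mean_bigsum; last by move=> i; apply: fin_norm; exact: fW.
apply: (@le_trans _ _ (\sum_(i < size c) e / 2 ^+ n)).
  apply: ler_sum => i _; have := mean_normZ (c`_i - ratr (q c`_i)) (@fin_W R (0 + i)).
  by rewrite /mean_norm => ->; rewrite -/(mean_norm _) mean_norm_W mulr1; exact: hq.
rewrite sumr_const card_ord sc -[X in X <= _]mulr_natr natrX divfK//.
Qed.

Lemma l1_fin (F : fn) : finite_depth F -> l1 leb I01 (fun t =>
  F (bits t)) = (mean_norm F)%:E.
Proof.
move=> fF; rewrite -integral_fin// /l1 /weighted_int.
by apply: eq_integral => t _; rewrite mulr1.
Qed.

Lemma wint_fin (mu : lebesgueR R -> R) (F : fn) :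
  measurable_fun I01 mu -> (forall x, I01 x -> 0 <= mu x <= 1) -> finite_depth F ->
  (weighted_int leb I01 mu (fun t => F (bits t)) <= (mean_norm F)%:E)%E.
Proof.
move=> mmu mu01 fF; rewrite -l1_fin//; have mF := fin_measurable fF.
have mI : measurable I01 by exact: measurable_itv_leb.
apply: ge0_le_integral; first exact: mI.
- by move=> x Dx; rewrite lee_fin mulr_ge0//; have /andP[] := mu01 x Dx.
- exact: measurable_wint.
- by apply: measurable_wint => //; exact: measurable_cst.
- by move=> x Dx; rewrite lee_fin ler_wpM2l//; have /andP[] := mu01 x Dx.
Qed.

Lemma walsh_dense (mu f : lebesgueR R -> R) (e : R) :
  measurable_fun I01 mu -> (forall x, I01 x -> 0 <= mu x <= 1) ->
  weighted_finite leb I01 mu f -> 0 < e ->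
  exists l, (weighted_int leb I01 mu (fun t => f t - wpoly l (bits t))%R <= e%:E)%E.
Proof.
move=> mmu mu01 wf e0; have e20 : 0 < e / 2 by rewrite divr_gt0.
have mI : measurable I01 by exact: measurable_itv_leb.
have lI : leb I01 = 1%E by exact: leb_I01.
have lebI : (leb I01 < +oo)%E by rewrite lI ltry.
have mu0 x : I01 x -> 0 <= mu x by move=> /mu01/andP[].
have [h [F fF hF] fh] := approximable_weighted mI on_bits_measurable
  (on_bits_cst 0) on_bitsD on_bitsZ approximable_indic lebI mmu mu01 wf e20.
have [l hl] := wpoly_dense fF e20; exists l.
have fFl : finite_depth (fun x => F x - wpoly l x) by apply: finD => //; apply:
  finN; exact: fin_wpoly.
have [mf _] := wf.
have mh : measurable_fun I01 h by apply: on_bits_measurable; exists F.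
have -> : (fun t => f t - wpoly l (bits t)) =
    (fun t => (f t - h t) + (F (bits t) - wpoly l (bits t))).
  by apply/funext => t; rewrite hF addrA subrK.
have m1 : measurable_fun I01 (fun t => f t - h t) by exact: measurable_funB.
apply: (le_trans (wintD leb mI mmu mu0 m1 (fin_measurable fFl))).
rewrite [e]splitr EFinD leeD//.
apply: (le_trans (wint_fin mmu mu01 fFl)); by rewrite lee_fin.
Qed.

End Density.

(** * The weight and the universal function *)

Lemma ereal_sub_lt {R : realType} (x u : \bar R) (d : R) :
  (1 <= x + u -> 0 <= x -> 0 <= u -> u < d%:E -> (1 - d)%:E < x)%E.
Proof.
move: x u => [x| |] [u| |] //; last by rewrite ltry.
by rewrite -EFinD !lte_fin !lee_fin => ? ? ? ?; lra.
Qed.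

Section WeightFunction.
Context {R : realType}.
Notation leb := (leb : {measure set (lebesgueR R) -> \bar R}).
Notation I01 := (I01 R).
Notation fn := ((nat -> bool) -> R).
Variables (A : nat -> fn) (K : nat -> R) (p : nat -> R).
Hypotheses (fA : forall n, finite_depth (A n)) (A01 : forall n x, A n x = 0 \/ A n x = 1)
  (EA : forall n, mean (A n) = p n) (K0 : forall n, 0 <= K n).

Definition penalty (t : lebesgueR R) : \bar R := (\sum_(n <oo) (K n * A n (bits t))%:E)%E.
(* Where the penalty is infinite (a null set, by Borel-Cantelli) [fine] gives 0
   and the weight is 1. *)
Definition damp (t : lebesgueR R) : R := (1 + fine (penalty t))^-1.

Let KA0 n (t : R) : (0 <= (K n * A n (bits t))%:E :> \bar R)%E.
Proof. by rewrite lee_fin mulr_ge0//; case: (A01 n (bits t)) => ->. Qed.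

Lemma penalty_ge0 t : (0 <= penalty t)%E.
Proof. by apply: nneseries_ge0 => n _ _; exact: KA0. Qed.

Lemma damp_gt0 t : 0 < damp t.
Proof. by rewrite invr_gt0 ltr_pwDl// fine_ge0// penalty_ge0. Qed.

Lemma damp_le1 t : damp t <= 1.
Proof. by rewrite invf_le1 ?lerDl ?ltr_pwDl// fine_ge0// penalty_ge0. Qed.

Let mI : measurable I01. Proof. exact: measurable_itv_leb. Qed.

Lemma measurable_damp : measurable_fun I01 damp.
Proof.
have mp : measurable_fun I01 penalty.
  apply: (@ge0_emeasurable_sum _ _ _ I01 (fun n t => (K n * A n (bits t))%:E) xpredT).
    by move=> n t _ _; exact: KA0.
  move=> n _; apply/measurable_EFinP; apply: measurable_funM; first exact: measurable_cst.
  exact: fin_measurable.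
rewrite (_ : damp = fun t => (1 + fine (penalty t)) `^ (-1)); last first.
  apply/funext => t; rewrite powR_inv1// addr_ge0// fine_ge0//; exact: penalty_ge0.
apply: (measurableT_comp (measurable_powR (-1))).
apply: measurable_funD; first exact: measurable_cst.
by apply: (measurableT_comp (f := fine)).
Qed.

Definition bad n : set (lebesgueR R) := I01 `&` [set t : lebesgueR R | A n (bits (t :
  R)) = 1].

Lemma measurable_bad n : measurable (bad n).
Proof. exact: (fin_measurable (fA n) mI (measurable_set1 (1 : R))). Qed.

Lemma leb_bad n : leb (bad n) = (p n)%:E.
Proof.
rewrite -EA.
have -> : mean (A n) = mean_norm (A n).
  by congr mean; apply/funext => x; case: (A01 n x) => ->; rewrite ?normr0 ?normr1.
rewrite -integral_fin// (eq_integral (fun t => (\1_(bad n) t)%:E)).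
  by rewrite integral_indic ?setIidl//; [exact: subIsetl|exact: measurable_bad].
move=> t /set_mem It; rewrite indicE; case: (A01 n (bits t)) => h.
  rewrite h normr0 memNset// => -[_ /=]; rewrite h => /esym/eqP; by rewrite oner_eq0.
by rewrite h normr1 mem_set.
Qed.

Hypothesis sump : (\sum_(n <oo) (p n)%:E < +oo)%E.

(** By Borel-Cantelli almost every t lies in finitely many bad sets. There the penalty is a finite
    sum, [fine] loses nothing, and each of the terms alone gives its bound. *)
Lemma damp_ae : {ae leb, forall t, I01 t -> forall n, A n (bits t) = 1 -> damp t <=
  (1 + K n)^-1}.
Proof.
have mlim : measurable (lim_sup_set bad).
  by apply: bigcapT_measurable => n; apply: bigcup_measurable => k _; exact: measurable_bad.
exists (lim_sup_set bad); split => //.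
  apply: lim_sup_set_cvg0; first exact: measurable_bad.
  by rewrite (eq_eseriesr (fun n _ => leb_bad n)).
move=> t /=; apply: contra_notP => nlim It n An.
have [N hN] : exists N, forall k, (N <= k)%N -> A k (bits t) = 0.
  apply: contrapT => h; apply: nlim => N _.
  have : ~ forall k, (N <= k)%N -> A k (bits t) = 0 by move=> h'; apply: h; exists N.
  move=> /existsNP[k /not_implyP[Nk Ak]]; exists k => //; split => //.
  by case: (A01 k (bits t)).
have pE : penalty t = (\sum_(0 <= k < N) K k * A k (bits t))%:E.
  rewrite /penalty (nneseries_split 0 N) => [|k _]; last exact: KA0.
  rewrite add0n eseries0 ?adde0 ?sumEFin// => k Nk _.
  by rewrite hN// mulr0.
rewrite lef_pV2 ?posrE ?ltr_pwDl// ?fine_ge0 ?penalty_ge0// lerD2l pE /=.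
have nN : (n < N)%N.
  by rewrite ltnNge; apply/negP => /hN; rewrite An => /eqP; rewrite oner_eq0.
rewrite big_mkord (bigD1 (Ordinal nN))//= An mulr1 lerDl sumr_ge0// => k _.
by rewrite -lee_fin KA0.
Qed.

(** Off the union of the bad sets every term of the penalty vanishes and the weight is 1. *)
Lemma leb_damp1 (d : R) : (\sum_(n <oo) (p n)%:E < d%:E)%E ->
  ((1 - d)%:E < leb [set t | I01 t /\ damp t = 1%R])%E.
Proof.
move=> pd; set S := [set t | _].
have mS : measurable S.
  exact: (measurable_damp mI (measurable_set1 (1 : R))).
have mU : measurable (\bigcup_n bad n).
  by apply: bigcupT_measurable; exact: measurable_bad.
have lU : (leb (\bigcup_n bad n) < d%:E)%E.
  apply: le_lt_trans pd; rewrite -(eq_eseriesr (fun n _ => leb_bad n)).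
  exact: (outer_measure_sigma_subadditive (mu_ext (@wlength R idfun)) bad).
have I01SU : I01 `<=` S `|` \bigcup_n bad n.
  move=> t It; have [h|h] := pselect ((\bigcup_n bad n) t); [by right|left; split=> //].
  rewrite /damp /penalty eseries0 ?addr0 ?invr1// => n _ _.
  case: (A01 n (bits t)) => An; first by rewrite An mulr0.
  by exfalso; apply: h; exists n.
have lI : leb I01 = 1%E by exact: leb_I01.
have mSU : measurable (S `|` \bigcup_n bad n) by exact: measurableU.
have h1 : (leb I01 <= leb (S `|` \bigcup_n bad n))%E by apply: le_measure; rewrite ?inE.
have h2 := le_trans h1 (measureU2 leb mS mU); rewrite lI in h2.
exact: (ereal_sub_lt h2 (measure_ge0 leb S) (measure_ge0 leb (\bigcup_n bad n)) lU).
Qed.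

End WeightFunction.

(* [logn 2] takes every value infinitely often. *)
Definition decode (n : nat) : seq rat := odflt [::] (unpickle (logn 2 n)).

Lemma decode_infinitely_often (l : seq rat) N : exists2 n, (N <= n)%N & decode n = l.
Proof.
exists (2 ^ pickle l * N.*2.+1)%N.
  apply: (@leq_trans N.*2.+1); first by rewrite -addnn leqW// leq_addl.
  by rewrite leq_pmull// expn_gt0.
rewrite /decode lognM ?expn_gt0// pfactorK// [logn 2 N.*2.+1]logn_coprime ?addn0 ?pickleK//.
by rewrite coprime2n /= odd_double.
Qed.

(** Assigns to each positive index its block; the index 0 precedes all blocks because N 0 = 1. *)
Lemma stage_index (N : nat -> nat) : N 0%N = 1%N -> (forall n, (N n < N n.+1)%N) ->
  exists st : nat -> nat,
    (forall k, (0 < k)%N -> (N (st k) <= k < N (st k).+1)%N) /\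
    (forall n k, (N n <= k < N n.+1)%N -> st k = n).
Proof.
move=> N0 NS.
have Nn n : (n < N n)%N.
  by elim: n => [|n IH]; [rewrite N0|exact: leq_ltn_trans IH (NS n)].
have Nmono m n : (m <= n)%N -> (N m <= N n)%N.
  exact: (homo_leq leqnn leq_trans (fun i => ltnW (NS i))).
have ex k : exists n, (k < N n.+1)%N by exists k; rewrite (ltn_trans (Nn k)).
pose st k := ex_minn (ex k); exists st.
have stP k : (k < N (st k).+1)%N /\ forall n, (k < N n.+1)%N -> (st k <= n)%N.
  by rewrite /st; case: ex_minnP.
split => [k k0|n k /andP[h1 h2]].
  have [-> h] := stP k; rewrite andbT.
  case E : (st k) => [|m]; first by rewrite N0.
  by rewrite leqNgt; apply/negP => /h; rewrite E ltnn.
have [h3 h4] := stP k; apply/eqP; rewrite eqn_leq h4//= leqNgt; apply/negP => stn.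
by move: h3; rewrite ltnNge (leq_trans _ h1)// Nmono.
Qed.

(** * From digits back to Walsh functions, coefficients and series on [0, 1] *)

Section Assembly.
Context {R : realType}.
Notation leb := (leb : {measure set (lebesgueR R) -> \bar R}).
Notation I01 := (I01 R).
Notation fn := ((nat -> bool) -> R).

Lemma measurable_I01 : measurable I01. Proof. exact: measurable_itv_leb. Qed.

(** The function agrees almost everywhere with a function of the digits, and the measure is
    complete. *)
Lemma measurable_walsh k : measurable_fun I01 (walsh k : lebesgueR R -> R).
Proof.
apply/measurable_EFinP.
have mW : measurable_fun I01 (EFin \o ((fun t => W k (bits t)) : lebesgueR R -> R)).
  by apply/measurable_EFinP; apply: fin_measurable; exact: fin_W.
apply: (ae_measurable_fun completed_lebesgue_measure_is_complete _ mW).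
by apply: (@filterS _ _ ae_leb_filter _ _ _ walsh_ae) => t h It /=; rewrite h.
Qed.

Lemma wint_walsh (w f : lebesgueR R -> R) (c : nat -> R) m :
  measurable_fun I01 w -> (forall t, I01 t -> 0 <= w t) -> measurable_fun I01 f ->
  (\int[leb]_(t in I01) (`|\sum_(k < m) c k * walsh k t - f t| * w t)%R%:E)%E =
  weighted_int leb I01 w (fun t => f t - psum c 0 m (bits t)).
Proof.
move=> mw w0 mf; have mI := measurable_I01.
have ms : measurable_fun I01 ((fun t => \sum_(k < m) c k * walsh k t) : lebesgueR R -> R).
  apply: measurable_sum => k; apply: measurable_funM; first exact: measurable_cst.
  exact: measurable_walsh.
have mp : measurable_fun I01 ((fun t => psum c 0 m (bits t)) : lebesgueR R -> R).
  by apply: fin_measurable; exact: fin_psum.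
apply: ge0_ae_eq_integral; first exact: mI.
- exact: (measurable_wint mw (measurable_funB ms mf)).
- exact: (measurable_wint mw (measurable_funB mf mp)).
- by move=> t It; rewrite lee_fin mulr_ge0// w0.
- by move=> t It; rewrite lee_fin mulr_ge0// w0.
apply: (@filterS _ _ ae_leb_filter _ _ _ walsh_ae) => t h It.
rewrite distrC /psum big_mkord; congr (`|_ - _| * _)%R%:E.
by apply: eq_bigr => k _; rewrite h.
Qed.

Lemma walsh_coef_bits (g : lebesgueR R -> R) k : L1 g ->
  L1 (fun t => g t * W k (bits t)) /\
  walsh_coef g k = \int[leb]_(t in I01) (g t * W k (bits t)).
Proof.
move=> Lg; have mI := measurable_I01; have /integrableP[/measurable_EFinP mg ig] := Lg.
have mW : measurable_fun I01 ((fun t => W k (bits t)) : lebesgueR R -> R).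
  by apply: fin_measurable; exact: fin_W.
split.
  apply/integrableP; split.
    by apply/measurable_EFinP; exact: measurable_funM.
  rewrite (eq_integral (fun t => `|(EFin \o g) t|)%E)// => t _ /=.
  by rewrite normrM normr_prod big1 ?mulr1// => i _; rewrite rad_norm.
rewrite /walsh_coef /Rintegral; congr fine; apply: ae_eq_integral; first exact: mI.
- apply/measurable_EFinP; apply: measurable_funM => //; exact: measurable_walsh.
- by apply/measurable_EFinP; exact: measurable_funM.
- by apply: (@filterS _ _ ae_leb_filter _ _ _ walsh_ae) => t h It /=; rewrite h.
Qed.

Lemma l1_integrable (f : lebesgueR R -> R) : measurable_fun I01 f ->
  (l1 leb I01 f < +oo)%E -> L1 f.
Proof.
move=> mf h; apply/integrableP; split; first exact/measurable_EFinP.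
apply: le_lt_trans h; rewrite /l1 /weighted_int.
by under [X in (_ <= X)%E]eq_integral do rewrite mulr1.
Qed.

Lemma psum_coef (a : nat -> R) m k : (k < m)%N ->
  mean (fun x => psum a 0 m x * W k x) = a k.
Proof.
move=> km; have [n hn] : exists n, forall i, (i < m)%N -> (i < 2 ^ n)%N.
  by exists m => i im; apply: ltn_trans im (ltn_expl _ _).
transitivity (mean (fun x => \sum_(i < m) a i * (W i x * W k x))).
  congr mean; apply/funext => x; rewrite /psum big_mkord mulr_suml.
  by apply: eq_bigr => i _; rewrite mulrA.
have fW i : finite_depth (fun x => W i x * W k x : R) by apply: finM; exact: fin_W.
rewrite mean_bigsum; last by move=> i; apply: finM; [exact: fin_cst|exact: fW].
rewrite (bigD1 (Ordinal km))//= big1 => [|i ik].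
  by rewrite meanZ// (@mean_WW _ n) ?hn// eqxx mulr1 addr0.
rewrite meanZ// (@mean_WW _ n) ?hn//.
by rewrite (_ : (_ == _) = false) ?mulr0//; apply/negbTE.
Qed.

(** A Walsh coefficient is continuous in the L^1 norm, since |W k| = 1, and every partial sum beyond
    k has the coefficient [a k]. *)
Lemma walsh_coef_lim (g : lebesgueR R -> R) (a : nat -> R) k : L1 g ->
  (forall e : R, 0 < e -> exists2 m, (k < m)%N &
    (l1 leb I01 (fun t => g t - psum a 0 m (bits t))%R <= e%:E)%E) ->
  walsh_coef g k = a k.
Proof.
move=> Lg h; have mI := measurable_I01; have [Lgk ->] := walsh_coef_bits k Lg.
apply/eqP; rewrite -subr_eq0 -normr_le0; apply/ler_addgt0Pr => e e0; rewrite add0r.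
have [m km hm] := h _ e0.
have fpk : finite_depth (fun x => psum a 0 m x * W k x).
  by apply: finM; [exact: fin_psum|exact: fin_W].
rewrite -(psum_coef a km) -Rintegral_fin//.
have Lp := fin_integrable01 fpk.
rewrite -RintegralB//; have LB := integrableB mI Lgk Lp.
apply: (le_trans (le_normr_Rintegral mI LB)).
rewrite -lee_fin; apply: le_trans hm.
rewrite /Rintegral fineK; last first.
  by apply: integrable_fin_num => //; exact: (integrable_norm LB).
rewrite le_eqVlt; apply/orP; left; apply/eqP; apply: eq_integral => t _.
by rewrite mulr1 -mulrBl normrM [`|W k _|]normr_prod big1 ?mulr1// => i _; rewrite rad_norm.
Qed.

Lemma walsh_series (a : nat -> R) (N : nat -> nat) (C : R) : N 0%N = 1%N ->
  (forall n, (N n <= N n.+1)%N) ->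
  (forall n, mean_norm (psum a (N n) (N n.+1)) <= C * 2 ^- n) ->
  exists2 g : lebesgueR R -> R, measurable_fun I01 g & forall n,
    (l1 leb I01 (fun t => g t - psum a 0 (N n) (bits t))%R <=
      ((`|a 0%N| + 2 * C) * 2 ^- n)%:E)%E.
Proof.
move=> N0 NS hC; have mI := measurable_I01.
(* The first summand is the term of index 0. Block n is therefore summand n+1, which is why 2C
   replaces C. *)
pose F n : fn := if n is n'.+1 then psum a (N n') (N n) else psum a 0 1.
have fF n : finite_depth (F n) by case: n => [|n]; exact: fin_psum.
have C0 : 0 <= C.
  have := le_trans (mean_norm_ge0 (@fin_psum R a _ _)) (hC 0%N).
  by rewrite expr0 invr1 mulr1.
have nF n : mean_norm (F n) <= (`|a 0%N| + 2 * C) * 2 ^- n.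
  have p0 : 0 <= 2 ^- n :> R by rewrite invr_ge0 exprn_ge0.
  case: n p0 => [|n] p0 /=.
    rewrite expr0 invr1 mulr1 (_ : psum a 0 1 = fun=> a 0%N).
      by rewrite mean_norm_cst lerDl mulr_ge0.
    by apply/funext => x; rewrite /psum big_nat1 W0 mulr1.
  apply: (le_trans (hC n)); rewrite mulrDl.
  have -> : C * 2 ^- n = 2 * C * 2 ^- n.+1.
    by rewrite exprS invfM; field; rewrite expf_neq0.
  by rewrite lerDr mulr_ge0.
have mF n : measurable_fun I01 ((fun t => F n (bits t)) : lebesgueR R -> R).
  exact: fin_measurable.
have iF n : (\int[leb]_(t in I01) (`|F n (bits t)|)%:E <=
  ((`|a 0%N| + 2 * C) * 2 ^- n)%:E)%E.
  by rewrite integral_fin// lee_fin.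
have [g mg hg] := L1_series mI mF iF; exists g => // n.
have Sn x : \sum_(k < n.+1) F k x = psum a 0 (N n) x.
  elim: n => [|n IH]; first by rewrite big_ord1 N0.
  rewrite big_ord_recr/= IH /psum -big_cat_nat//=.
have := hg n.+1; rewrite /l1 /weighted_int.
have -> : 2 * (`|a 0%N| + 2 * C) * 2 ^- n.+1 = (`|a 0%N| + 2 * C) * 2 ^- n.
  by rewrite exprS invfM; field; rewrite expf_neq0.
apply: le_trans; rewrite le_eqVlt; apply/orP; left; apply/eqP; apply: eq_integral => t _.
by rewrite mulr1 Sn.
Qed.

End Assembly.

(** * The choice of signs for a given function *)

Section Universal.
Context {R : realType}.
Notation leb := (leb : {measure set (lebesgueR R) -> \bar R}).
Notation I01 := (I01 R).
Notation fn := ((nat -> bool) -> R).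
Variables (mu : lebesgueR R -> R) (a sg : nat -> R) (N : nat -> nat) (nu : nat -> nat)
  (A : nat -> fn).
Let tgt n : fn := wpoly (decode n).
Let sa j := sg j * a j.
Hypotheses (mmu : measurable_fun I01 mu) (mu01 : forall t, I01 t -> 0 <= mu t <= 1)
  (sg1 : forall k, sg k = -1 \/ sg k = 1) (N0 : N 0%N = 1%N)
  (NS : forall n, (N n < N n.+1)%N)
  (fA : forall n, finite_depth (A n)) (A01 : forall n x, A n x = 0 \/ A n x = 1)
  (hg : forall n k, (N n <= k <= N n.+1)%N -> mean_norm (psum a (N n) k) <= 3 * 2 ^- n)
  (hu : forall n k, (N n <= k <= N n.+1)%N -> exists u, [/\ finite_depth u,
    dominated (nu n) (tgt n) (A n) u &
         mean_norm (fun x => psum sa (N n) k x - u x) <= 3 * 2 ^- n])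
  (hq : forall n, mean_norm (fun x => psum sa (N n) (N n.+1) x
         - tgt n x * (1 - 2 ^+ nu n * A n x)) <= 3 * 2 ^- n)
  (decay : {ae leb, forall t, I01 t -> forall n, A n (bits t) = 1 ->
     2 ^+ nu n * `|tgt n (bits t)| * mu t <= 2 ^- n}).

Let M := weighted_norm leb I01 mu.
Let cl := weighted_finite leb I01 mu.
Let on (F : fn) : lebesgueR R -> R := fun t => F (bits t).
Let mI := @measurable_I01 R.
Let mu0 t : I01 t -> 0 <= mu t. Proof. by move=> /mu01/andP[]. Qed.

Let on_fin F : finite_depth F -> cl (on F) /\ M (on F) <= mean_norm F.
Proof.
move=> fF; apply: wnm_bound => //; first exact: fin_measurable.
exact: wint_fin.
Qed.

Let ft n : finite_depth (tgt n). Proof. exact: fin_wpoly. Qed.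
Let fp b m n : finite_depth (psum b m n : fn). Proof. exact: fin_psum. Qed.

(** The part of block n that misses its target: large on [A n], but of weighted norm at most 2^-n by
    [decay]. *)
Let B n : fn := fun x => 2 ^+ nu n * tgt n x * A n x.
Let fB n : finite_depth (B n).
Proof. by apply: finM => //; apply: finM => //; exact: fin_cst. Qed.

Let MBn n : M (on (B n)) <= 2 ^- n.
Proof.
have [] // := @wnm_bound _ _ _ leb I01 mu mu0 (on (B n)) (2 ^- n) (fin_measurable (fB n)).
apply: (@le_trans _ _ (\int[leb]_(t in I01) (2 ^- n)%:E)%E).
  apply: ae_ge0_le_integral.
  - exact: mI.
  - by move=> t It; rewrite lee_fin mulr_ge0// mu0.
  - exact: (measurable_wint mmu (fin_measurable (fB n))).
  - by move=> t It; rewrite lee_fin invr_ge0 exprn_ge0.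
  - exact: measurable_cst.
  apply: (@filterS _ _ ae_leb_filter _ _ _ decay) => t h It; rewrite lee_fin /on /B.
  have [At|At] := A01 n (bits t).
    by rewrite At mulr0 normr0 mul0r invr_ge0 exprn_ge0.
  rewrite At mulr1 normrM (ger0_norm (exprn_ge0 _ (ler0n R 2))); exact: h.
rewrite integral_cst//.
have lI' : (leb I01 <= 1)%E.
  by rewrite le_eqVlt; apply/orP; left; apply/eqP; exact: leb_I01.
apply: le_trans (lee_wpmul2l _ lI') _; first by rewrite lee_fin invr_ge0 exprn_ge0.
by rewrite mule1.
Qed.

Let clB u v : cl u -> cl v -> cl (u - v). Proof. exact: wfinB. Qed.
Let MB u v : cl u -> cl v -> M (u - v) <= M u + M v. Proof. exact: wnmB. Qed.
Let M0 u : 0 <= M u. Proof. exact: wnm_ge0. Qed.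
Let MN u : M (- u) = M u. Proof. exact: wnmN. Qed.

(** The factor 2^nu of [dominated] acts only on [A n], where it produces |B n|, which the weight
    makes small. *)
Let Mu n u : finite_depth u -> dominated (nu n) (tgt n) (A n) u -> M (on u) <=
  M (on (tgt n)) + 2 ^- n.
Proof.
move=> fu bu; pose h x : R := `|tgt n x| + `|B n x|.
have fh : finite_depth h by apply: finD; exact: fin_norm.
have [_ h1] : cl (on u) /\ M (on u) <= M (on h).
  apply: wnm_le => //; [exact: fin_measurable|by have [] := on_fin fh|].
  apply: aeW => t It; rewrite ler_wpM2r ?mu0// /on [leRHS]ger0_norm ?addr_ge0//.
  apply: (le_trans (bu (bits t))); rewrite /h /B.
  rewrite !normrM (ger0_norm (exprn_ge0 _ (ler0n R 2))).
  case: (A01 n (bits t)) => ->; rewrite ?normr0 ?normr1; have := normr_ge0 (tgt n (bits t)).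
    by lra.
  by move=> ?; rewrite subrr mulr0 add0r lerDr.
apply: (le_trans h1).
have [c1 _] := on_fin (fin_norm (ft n)); have [c2 _] := on_fin (fin_norm (fB n)).
apply: (le_trans (wnmD _ _ _ c1 c2)) => //.
apply: lerD.
  have [] // := @wnm_le _ _ _ leb I01 mu mI mmu mu0 _ (on (tgt n))
    (fin_measurable (fin_norm (ft n))).
    by have [] := on_fin (ft n).
  by apply: aeW => t It; rewrite normr_id.
apply: le_trans (MBn n).
have [] // := @wnm_le _ _ _ leb I01 mu mI mmu mu0 _ (on (B n)) (fin_measurable (fin_norm (fB n))).
  by have [] := on_fin (fB n).
by apply: aeW => t It; rewrite normr_id.
Qed.

Variable f : lebesgueR R -> R.
Hypothesis wf : cl f.

Let p n := on (psum sa (N n) (N n.+1)).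
Let g n := on (psum a (N n) (N n.+1)).
Let t n := on (tgt n).
Let r0 := f - on (psum a 0 1).

Let NSS n : (N n <= N n.+1 <= N n.+1)%N. Proof. by rewrite leqnn ltnW. Qed.

Let pn n : 0 <= 2 ^- n :> R. Proof. by rewrite invr_ge0 exprn_ge0. Qed.

Let Mp n : M (p n - t n) <= 4 * 2 ^- n.
Proof.
pose h x := psum sa (N n) (N n.+1) x - tgt n x * (1 - 2 ^+ nu n * A n x).
have fh : finite_depth h.
  apply: finD => //; apply: finN; apply: finM => //; apply: finD; first exact: fin_cst.
  by apply: finN; apply: finM => //; exact: fin_cst.
have [c1 h1] := on_fin fh; have [c2 _] := on_fin (fB n).
have -> : p n - t n = on h - on (B n).
  by apply/funext => x; rewrite /p /t /on /h /B !fctE; ring.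
apply: (le_trans (MB c1 c2)).
have := hq n; have := MBn n; rewrite -/h => h2 h3; have := le_trans h1 h3.
by move: h2; lra.
Qed.

Let Mg n : M (g n) <= 4 * 2 ^- n.
Proof.
have [_ h] := on_fin (fp a (N n) (N n.+1)); apply: (le_trans h).
by apply: (le_trans (hg (NSS n))); have := pn n; lra.
Qed.

Let dense h : cl h -> forall e n0, 0 < e -> exists2 n, (n0 <= n)%N & M (h - t n) < e.
Proof.
move=> ch e n0 e0; have e20 : 0 < e / 2 by rewrite divr_gt0.
have [l hl] := walsh_dense mmu mu01 ch e20.
have [n nn0 hn] := decode_infinitely_often l n0; exists n => //.
have mht : measurable_fun I01 (h - t n).
  by apply: measurable_funB; [case: ch|exact: fin_measurable].
have [//|_ h2] := @wnm_bound _ _ _ leb I01 mu mu0 (h - t n) (e / 2) mht.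
  by apply: le_trans hl; rewrite /t /tgt hn.
by apply: (le_lt_trans h2); rewrite ltr_pdivrMr// ltr_pMr// ltr1n.
Qed.

Lemma universal_signs : exists d : nat -> R, (forall k, d k = -1 \/ d k = 1) /\
  forall e : R, 0 < e -> exists m0, forall m, (m0 <= m)%N ->
    (weighted_int leb I01 mu (fun x => f x - psum (fun k =>
      d k * a k) 0 m (bits x))%R <= e%:E)%E.
Proof.
have clp n : cl (p n) by have [] := on_fin (fp sa (N n) (N n.+1)).
have clg n : cl (g n) by have [] := on_fin (fp a (N n) (N n.+1)).
have clt n : cl (t n) by have [] := on_fin (ft n).
have clr0 : cl r0 by apply: clB => //; have [] := on_fin (fp a 0 1).
have cvg := greedy_cvg clB M0 MB clp clg clt clr0 Mp Mg dense.
pose res := residual M p g t r0; pose acc n := accept M t (res n) n.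
have [st [st1 st2]] := stage_index N0 NS.
have Nmono m n : (m <= n)%N -> (N m <= N n)%N.
  exact: (homo_leq leqnn leq_trans (fun i => ltnW (NS i))).
have Npos n : (0 < N n)%N by rewrite -N0 Nmono.
(* The index 0 has the sign 1 in accordance with [r0], from which the greedy choice starts. *)
pose d k : R := if k == 0%N then 1 else if acc (st k) then sg k else 1.
pose da k := d k * a k.
have stageE n k : (N n <= k <= N n.+1)%N ->
    psum da (N n) k = if acc n then psum sa (N n) k else psum a (N n) k.
  move=> /andP[_ h2].
  have daE j : (N n <= j < k)%N -> da j = if acc n then sa j else a j.
    move=> /andP[j1 j2].
    have stj : st j = n by apply: st2; rewrite j1 (leq_trans j2).
    rewrite /da /d stj (_ : (j == 0%N) = false); last first.
      by apply/negbTE; rewrite -lt0n (leq_trans (Npos n)).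
    by case: (acc n) => //; rewrite mul1r.
  by move: daE; case: (acc n) => daE; apply/funext => x; apply: eq_big_nat => j /daE ->.
have catE m n k x : (m <= n)%N -> (n <= k)%N ->
    psum da m k x = psum da m n x + psum da n k x.
  by move=> mn nk; rewrite /psum (big_cat_nat mn nk).
have resE n : res n = f - on (psum da 0 (N n)).
  elim: n => [|n IH].
    rewrite /res /= /r0; congr (f - _); apply/funext => x.
    by rewrite /on /psum N0 !big_nat1 /da /d eqxx mul1r.
  rewrite /res /= -/(res n) -/(acc n) IH; apply/funext => x; rewrite !fctE.
  rewrite {2}/on (catE _ (N n))//; last exact: ltnW.
  rewrite (stageE _ _ (NSS n)) /p /g /on; case: (acc n); ring.
exists d; split.
  by move=> k; rewrite /d; case: eqP => _; [right|case: (acc _); [exact: sg1|right]].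
move=> e e0.
have e60 : 0 < e / 6 by rewrite divr_gt0.
have [n1 hn1] := cvg _ e60.
have [n2 hn2] := small_geo (ler0n R 4) (divr_gt0 e0 (ltr0n R 2)).
exists (N (maxn n1 n2)) => m hm.
have m0 : (0 < m)%N by exact: leq_trans hm.
have /andP[h1 h2] := st1 m m0; set n := st m in h1 h2.
have nn : (maxn n1 n2 <= n)%N.
  rewrite leqNgt; apply/negP => h; have := leq_trans h2 (Nmono _ _ h).
  by rewrite ltnNge hm.
have r1 := hn1 n (leq_trans (leq_maxl _ _) nn).
have r2 := hn2 n (leq_trans (leq_maxr _ _) nn).
have hm2 : (N n <= m <= N n.+1)%N by rewrite h1 ltnW.
have clres : cl (res n) by exact: (@cl_residual R _ M cl clB p g t r0 clp clg clr0).
have clpart : cl (on (psum da (N n) m)) by have [] := on_fin (fp da (N n) m).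
have -> : (fun x => f x - psum da 0 m (bits x)) = res n - on (psum da (N n) m).
  by rewrite resE; apply/funext => x; rewrite !fctE /on (catE _ (N n))// opprD addrA.
rewrite -(wnmK mu0 (clB clres clpart)) lee_fin -/M.
apply: (le_trans (MB clres clpart)).
(* It remains to bound an incomplete block. A rejected one is small by construction. An accepted one
   is comparable with its target, and acceptance bounds the target by 3/2 of the residual. In all
   the distance is at most 3 (e/6) + e/2 = e. *)
suff hp : M (on (psum da (N n) m)) <= 2 * M (res n) + 4 * 2 ^- n.
  have r1' : M (res n) <= e / 6 := r1.
  by lra.
rewrite (stageE _ _ hm2); have := M0 (res n); have := pn n; case: ifPn => an.
  move=> q1 q2; have [u [fu bu hpu]] := hu hm2.
  have fpu : finite_depth (fun x => psum sa (N n) m x - u x) by apply: finD =>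
    //; exact: finN.
  have [c1 k1] := on_fin fpu; have [c2 _] := on_fin fu.
  have -> : on (psum sa (N n) m) = on (fun x =>
    psum sa (N n) m x - u x) - on (fun x => - u x).
    by apply/funext => x; rewrite !fctE /on opprK subrK.
  have [c3 _] := on_fin (finN fu).
  apply: (le_trans (MB c1 c3)).
  have k2 : M (on (fun x => - u x)) = M (on u) by exact: MN.
  have k3 := Mu fu bu.
  have k4 : M (t n) <= M (res n) + M (res n - t n).
    rewrite {1}(_ : t n = res n - (res n - t n)); last by rewrite opprB addrC subrK.
    by apply: MB => //; exact: clB.
  have k5 : M (res n - t n) < M (res n) / 2 := an.
  have k6 := le_trans k1 hpu.
  rewrite k2; rewrite -/(t n) in k3; lra.
move=> q1 q2; have [_ k1] := on_fin (fp a (N n) m).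
by have := le_trans k1 (hg hm2); lra.
Qed.

End Universal.

Lemma sum_pow2 {R : realType} n0 (d : R) : 2 * 2 ^- n0 < d ->
  (\sum_(n <oo) (2 ^- (n + n0) : R)%:E < d%:E)%E.
Proof.
move=> h; apply: (@le_lt_trans _ _ (2 * 2 ^- n0)%:E); last by rewrite lte_fin.
apply: lime_le.
  by apply: is_cvg_nneseries => n _ _; rewrite lee_fin invr_ge0 exprn_ge0.
apply: nearW => m; rewrite sumEFin lee_fin.
have := @sum_geo R n0 (m + n0); rewrite -{1}[n0]add0n big_addn addnK.
by [].
Qed.

(** [walsh_series] controls the partial sums at the ends of blocks; inside block n, where all signs
    are positive, the deviation is at most C 2^-n. *)
Lemma walsh_sum_cvg {R : realType} (a : nat -> R) (N : nat -> nat) (C : R)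
    (g : lebesgueR R -> R) : N 0%N = 1%N -> (forall n, (N n < N n.+1)%N) ->
  measurable_fun (I01 R) g ->
  (forall n k, (N n <= k <= N n.+1)%N -> mean_norm (psum a (N n) k) <= C * 2 ^- n) ->
  (forall n, (l1 leb (I01 R) (fun t => g t - psum a 0 (N n) (bits t))%R <=
      ((`|a 0%N| + 2 * C) * 2 ^- n)%:E)%E) ->
  forall e : R, 0 < e -> exists m0, forall m, (m0 <= m)%N ->
    (l1 leb (I01 R) (fun t => g t - psum a 0 m (bits t))%R <= e%:E)%E.
Proof.
move=> N0 NS mg hC hS e e0; have mI := @measurable_I01 R.
have C0 : 0 <= C.
  have := le_trans (mean_norm_ge0 (@fin_psum R a _ _)) (hC 0%N (N 0%N) _).
  by rewrite expr0 invr1 mulr1 leqnn ltnW//; apply.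
have [st [st1 st2]] := stage_index N0 NS.
have Nmono m n : (m <= n)%N -> (N m <= N n)%N.
  exact: (homo_leq leqnn leq_trans (fun i => ltnW (NS i))).
have D0 : 0 <= `|a 0%N| + 3 * C by rewrite addr_ge0// mulr_ge0.
have [n2 hn2] := small_geo D0 e0.
exists (N n2) => m hm.
have m0 : (0 < m)%N by rewrite (leq_trans _ hm)// -N0 Nmono.
have /andP[h1 h2] := st1 m m0; set n := st m in h1 h2.
have nn : (n2 <= n)%N.
  rewrite leqNgt; apply/negP => h; have := leq_trans h2 (Nmono _ _ h).
  by rewrite ltnNge hm.
have hm2 : (N n <= m <= N n.+1)%N by rewrite h1 ltnW.
have fp k l : finite_depth (psum a k l) by exact: fin_psum.
apply: (le_trans (l1_triangle leb mI mg (fin_measurable (fp 0%N (N n)))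
  (fin_measurable (fp 0%N m)))).
have -> : l1 leb (I01 R) (fun t => psum a 0 (N n) (bits t) - psum a 0 m (bits t))%R =
    (mean_norm (psum a (N n) m))%:E.
  rewrite -l1_fin// /l1 /weighted_int; apply: eq_integral => t _.
  by rewrite /psum [in X in _ - X](big_cat_nat (leq0n _) h1)/= opprD addrA subrr add0r normrN.
apply: (@le_trans _ _ (((`|a 0%N| + 2 * C) * 2 ^- n)%:E + (C * 2 ^- n)%:E)%E).
  by rewrite leeD// lee_fin hC.
rewrite -EFinD lee_fin -mulrDl -addrA (_ : 2 * C + C = 3 * C); last by ring.
exact: hn2.
Qed.

Theorem mainTheorem2 (R : realType) (delta : R) (hdelta : 0 < delta < 1) :
  exists g mu : lebesgueR R -> R,
    L1 g /\ weight mu /\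
    ((1 - delta)%:E < leb [set x | I01 R x /\ mu x = 1%R])%E /\
    (forall k : nat, walsh_coef g k.+1 < walsh_coef g k) /\
    ((\int[leb]_(x in I01 R)
        (`|\sum_(k < m.+1) walsh_coef g k * walsh k x - g x|%R)%:E)%E
      @[m --> \oo] --> 0%E) /\
    (forall f : lebesgueR R -> R, weightedL1 mu f ->
      exists d : nat -> R, (forall k, d k = -1 \/ d k = 1) /\
        ((\int[leb]_(x in I01 R)
            (`|\sum_(k < m.+1) d k * walsh_coef g k * walsh k x - f x|
             * mu x)%R%:E)%E
          @[m --> \oo] --> 0%E)).
Proof.
have /andP[delta0 delta1] := hdelta; have mI := @measurable_I01 R.
(* The sets [A n] will have measure 2^-(n + n0), with sum at most 2 * 2^-n0 <= delta/2. *)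
have [n0 hn0] := small_geo (ler0n R 2) (divr_gt0 delta0 (ltr0n R 2)).
have {}hn0 := hn0 n0 (leqnn n0).
pose nu n := (n + n0)%N.
have ft n : finite_depth (wpoly (decode n) : _ -> R) by exact: fin_wpoly.
have [a [sg [N [A [[adec sg1 N0 NS] [hA hg hu hq]]]]]] := construction nu ft.
have fA n : finite_depth (A n) by case: (hA n).
have A01 n x : A n x = 0 \/ A n x = 1 by case: (hA n).
have EA n : mean (A n) = 2 ^- (n + n0) by case: (hA n).
have /choice[B hB] : forall n, exists B : R, 0 <= B /\ forall x, `|wpoly (decode n) x| <= B.
  by move=> n; have [B ? ?] := fin_bounded (ft n); exists B.
(* With B n a bound for the target, 2^nu B n / (1 + K n) is at most 2^-n, as [decay] requires. *)
pose K n := 2 ^+ nu n * B n * 2 ^+ n.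
have K0 n : 0 <= K n.
  by have [B0 _] := hB n; rewrite /K !mulr_ge0// exprn_ge0.
have sum_lt : (\sum_(n <oo) (2 ^- (n + n0) : R)%:E < delta%:E)%E.
  apply: sum_pow2; apply: (le_lt_trans hn0).
  by rewrite ltr_pdivrMr// ltr_pMr// ltr1n.
have sum_fin : (\sum_(n <oo) (2 ^- (n + n0) : R)%:E < +oo)%E.
  by rewrite (lt_trans sum_lt)// ltry.
pose mu := damp A K.
have mmu : measurable_fun (I01 R) mu by exact: measurable_damp.
have mu0 x : 0 < mu x by exact: damp_gt0.
have mu1 x : mu x <= 1 by exact: damp_le1.
have mu01 x : I01 R x -> 0 <= mu x <= 1 by move=> _; rewrite ltW// mu1.
have [g mg hgS] := walsh_series N0 (fun n => ltnW (NS n))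
  (fun n => hg n (N n.+1) (introT andP (conj (ltnW (NS n)) (leqnn _)))).
have gcvg := walsh_sum_cvg N0 NS mg hg hgS.
have w1 : measurable_fun (I01 R) ((fun=> 1) : lebesgueR R -> R).
  exact: measurable_cst.
have Lg : L1 g.
  have [m0 /(_ m0 (leqnn _)) h] := gcvg 1 ltr01.
  apply: l1_integrable => //.
  have mp : measurable_fun (I01 R) ((fun t => psum a 0 m0 (bits t)) : lebesgueR R -> R).
    by apply: fin_measurable; exact: fin_psum.
  have := wintD leb mI w1 (fun _ _ => ler01) (measurable_funB mg mp) mp.
  have -> : (fun x => (g x - psum a 0 m0 (bits x)) + psum a 0 m0 (bits x)) = g.
    by apply/funext => t; rewrite subrK.
  move=> /le_lt_trans; apply; apply: lte_add_pinfty.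
    by apply: (le_lt_trans h); rewrite ltry.
  by rewrite -/(l1 _ _ _) l1_fin ?ltry//; exact: fin_psum.
have coefE k : walsh_coef g k = a k.
  apply: walsh_coef_lim => // e e0; have [m0 hm0] := gcvg e e0.
  by exists (maxn k.+1 m0); [exact: leq_maxl|apply: hm0; exact: leq_maxr].
have decay : {ae (leb : {measure set (lebesgueR R) -> \bar R}), forall t, I01 R t ->
    forall n, A n (bits t) = 1 ->
    2 ^+ nu n * `|wpoly (decode n) (bits t)| * mu t <= 2 ^- n}.
  apply: (@filterS _ _ ae_leb_filter _ _ _ (damp_ae fA A01 EA K0 sum_fin)) => t h It n An.
  have [B0 /(_ (bits t)) BB] := hB n.
  apply: (@le_trans _ _ (2 ^+ nu n * B n * (1 + K n)^-1)).
    apply: ler_pM; [by rewrite mulr_ge0// exprn_ge0|exact: ltW| |exact: h].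
    by rewrite ler_wpM2l// exprn_ge0.
  have K1 : 0 < 1 + K n by rewrite ltr_pwDl.
  have p2 : 0 < 2 ^+ n :> R by rewrite exprn_gt0.
  by rewrite ler_pdivrMr// [2 ^- n * _]mulrC ler_pdivlMr// /K lerDr.
exists g, mu; split => //; split; first by split => // x _; rewrite mu0 mu1.
split; first exact: (leb_damp1 fA A01 EA K0 sum_lt).
split; first by move=> k; rewrite !coefE.
split.
  have -> : (fun m => \int[leb]_(x in I01 R)
      (`|\sum_(k < m.+1) walsh_coef g k * walsh k x - g x|%R)%:E)%E =
      fun m => l1 leb (I01 R) (fun t => g t - psum a 0 m.+1 (bits t)).
    apply/funext => m; rewrite /l1 -(wint_walsh a m.+1 w1 (fun _ _ => ler01) mg).
    apply: eq_integral => t _; rewrite mulr1.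
    by under eq_bigr do rewrite coefE.
  apply/cvge0P; first by move=> m; exact: wint_ge0.
  move=> e e0; have [m0 hm0] := gcvg e e0; exists m0 => m m0m.
  by apply: hm0; exact: leqW.
move=> f wf.
have [d [d1 hd]] := universal_signs mmu mu01 sg1 N0 NS fA A01 hg hu hq decay wf.
exists d; split => //.
have -> : (fun m => \int[leb]_(x in I01 R)
    (`|\sum_(k < m.+1) d k * walsh_coef g k * walsh k x - f x| * mu x)%R%:E)%E =
    fun m => weighted_int leb (I01 R) mu (fun t => f t - psum (fun k =>
      d k * a k) 0 m.+1 (bits t)).
  apply/funext => m; rewrite -(wint_walsh (fun k => d k * a k) m.+1 mmu
    (fun t _ => ltW (mu0 t)) (proj1 wf)).
  apply: eq_integral => t _.
  by under eq_bigr do rewrite coefE.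
apply/cvge0P; first by move=> m; apply: wint_ge0 => t /mu01/andP[].
move=> e e0; have [m0 hm0] := hd e e0; exists m0 => m m0m.
by apply: hm0; exact: leqW.
Qed.
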